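(* Let $k$ be an infinite field of characteristic $0$ such that $\mathrm{Aut}\,k=\{\mathrm{id}_k\}$. Then two representations $H_1,H_2\in\Xi$ of Lie algebras over $k$ are automorphically equivalent if and only if they are geometrically equivalent.
   Context: A representation $(L,V)$ consists of a Lie algebra $L$ over $k$ and a $k$-vector space $V$ which is an $L$-module (action $l\circ v$). A homomorphism $(\varphi,\psi):(L_1,V_1)\to(L_2,V_2)$ is a Lie algebra homomorphism $\varphi:L_1\to L_2$ and a linear map $\psi:V_1\to V_2$ with $\varphi(l)\circ\psi(v)=\psi(l\circ v)$. $\Xi$ is the class of all representations (viewed as 2-sorted algebras). For a set $X$ let $L(X)$ be the free Lie algebra on $X$, $A(X)$ the free associative algebra with unit on $X$, and $W(X,Y)=(L(X),A(X)Y)$ where $A(X)Y=\bigoplus_{y\in Y}A(X)y$ is the free $A(X)$-module with basis $Y$; this is the free representation on $(X,Y)$. Fix countably infinite sets $X^0,Y^0$; $\Xi^0$ is the category whose objects are the $W(X,Y)$ with finite $X\subset X^0$, $Y\subset Y^0$, and whose morphisms are all homomorphisms between them. For $H\in\Xi$, $W=W(X,Y)\in\mathrm{Ob}\,\Xi^0$ and $T_1\subseteq L(X)$, $T_2\subseteq A(X)Y$, let $(T_1,T_2)'_H=\{(\varphi,\psi)\in\mathrm{Hom}(W,H): T_1\subseteq\ker\varphi,\ T_2\subseteq\ker\psi\}$ and $(T_1,T_2)''_H=\big(\bigcap_{(\varphi,\psi)\in(T_1,T_2)'_H}\ker\varphi,\ \bigcap_{(\varphi,\psi)\in(T_1,T_2)'_H}\ker\psi\big)$.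 $(T_1,T_2)$ is $H$-closed if $(T_1,T_2)''_H=(T_1,T_2)$; $Cl_H(W)$ denotes the set of $H$-closed pairs in $W$. $H_1,H_2$ are geometrically equivalent if $(T_1,T_2)''_{H_1}=(T_1,T_2)''_{H_2}$ for all $W\in\mathrm{Ob}\,\Xi^0$ and all $(T_1,T_2)$ in $W$. For $W_1=W(X_1,Y_1),W_2=W(X_2,Y_2)$ and a congruence $(T_1,T_2)$ of $W_2$, $\beta_{W_1,W_2}(T_1,T_2)$ is the relation on $\mathrm{Hom}(W_1,W_2)$: $((\varphi_1,\psi_1),(\varphi_2,\psi_2))\in\beta$ iff $\varphi_1(l)-\varphi_2(l)\in T_1$ for all $l\in L(X_1)$ and $\psi_1(v)-\psi_2(v)\in T_2$ for all $v\in A(X_1)Y_1$. $H_1,H_2$ are automorphically equivalent if there exist an automorphism $\Phi$ of the category $\Xi^0$ and bijections $\alpha_W:Cl_{H_1}(W)\to Cl_{H_2}(\Phi(W))$ for all $W\in\mathrm{Ob}\,\Xi^0$ such that $\Phi(\beta_{W_1,W_2}(T_1,T_2))=\beta_{\Phi(W_1),\Phi(W_2)}(\alpha_{W_2}(T_1,T_2))$ for all $W_1,W_2$ and all $(T_1,T_2)\in Cl_{H_1}(W_2)$, where $\Phi$ acts on pairs of morphisms componentwise. *)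

(* Defs.v *)
From HB Require Import structures.
From mathcomp Require Import all_boot all_algebra.
From mathcomp Require Import finmap.
Set Implicit Arguments. Unset Strict Implicit. Unset Printing Implicit Defensive.
Import GRing.Theory.
Local Open Scope ring_scope.

Section Reps.
Variable k : fieldType.

Record lieSig := LieSig {
  lcar :> Type;
  lzero : lcar;
  ladd : lcar -> lcar -> lcar;
  lopp : lcar -> lcar;
  lscale : k -> lcar -> lcar;
  lbr : lcar -> lcar -> lcar }.

Record repSig := RepSig {
  rL : lieSig;
  rV : Type;
  vzero : rV;
  vadd : rV -> rV -> rV;
  vopp : rV -> rV;
  vscale : k -> rV -> rV;
  ract : rL -> rV -> rV }.

Definition is_vspace (T : Type) (z : T) (add : T -> T -> T) (opp : T -> T)
    (sc : k -> T -> T) : Prop :=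
  [/\ (forall x y w, add x (add y w) = add (add x y) w),
      (forall x y, add x y = add y x),
      (forall x, add z x = x),
      (forall x, add (opp x) x = z) &
   [/\ (forall c x y, sc c (add x y) = add (sc c x) (sc c y)),
       (forall c d x, sc (c + d) x = add (sc c x) (sc d x)),
       (forall c d x, sc (c * d) x = sc c (sc d x)) &
       (forall x, sc 1 x = x)]].

Definition is_lie (L : lieSig) : Prop :=
  [/\ is_vspace (lzero L) (@ladd L) (@lopp L) (@lscale L),
      (forall x y z : L, lbr (ladd x y) z = ladd (lbr x z) (lbr y z)),
      (forall x y z : L, lbr x (ladd y z) = ladd (lbr x y) (lbr x z)),
      (forall c (x y : L), lbr (lscale c x) y = lscale c (lbr x y)) &
   [/\ (forall c (x y : L), lbr x (lscale c y) = lscale c (lbr x y)),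
       (forall x : L, lbr x x = lzero L) &
       (forall x y z : L, ladd (lbr x (lbr y z)) (ladd (lbr y (lbr z x)) (lbr z (lbr x y)))
                      = lzero L)]].

Definition is_rep (H : repSig) : Prop :=
  [/\ is_lie (rL H),
      is_vspace (vzero H) (@vadd H) (@vopp H) (@vscale H),
      (forall (l1 l2 : rL H) v, ract (ladd l1 l2) v = vadd (ract l1 v) (ract l2 v)),
      (forall (l : rL H) v1 v2, ract l (vadd v1 v2) = vadd (ract l v1) (ract l v2)) &
   [/\ (forall c (l : rL H) v, ract (lscale c l) v = vscale c (ract l v)),
       (forall c (l : rL H) v, ract l (vscale c v) = vscale c (ract l v)) &
       (forall (l1 l2 : rL H) v, ract (lbr l1 l2) v =
          vadd (ract l1 (ract l2 v)) (vopp (ract l2 (ract l1 v))))]].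

Definition is_hom (H G : repSig) (phi : rL H -> rL G) (psi : rV H -> rV G) : Prop :=
  [/\ (forall x y, phi (ladd x y) = ladd (phi x) (phi y)),
      (forall c x, phi (lscale c x) = lscale c (phi x)),
      (forall x y, phi (lbr x y) = lbr (phi x) (phi y)),
      (forall u v, psi (vadd u v) = vadd (psi u) (psi v)) &
   [/\ (forall c v, psi (vscale c v) = vscale c (psi v)) &
       (forall l v, ract (phi l) (psi v) = psi (ract l v))]].

(* Free objects.  X^0 = Y^0 = nat.                                      *)
(* A(X): finitely supported k-valued functions on words over X, with   *)
(*       concatenation product.                                        *)
(* L(X): the Lie subalgebra of A(X) (commutator bracket) generated by X *)
(*       (the standard model of the free Lie algebra on X).            *)
(* A(X)Y: finitely supported functions on (word over X) * Y.           *)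
Definition word := seq nat.

Definition delta1 (x : nat) : word -> k := fun w => (w == [:: x])%:R.

Definition convA (a b : word -> k) : word -> k :=
  fun w => \sum_(i < (size w).+1) a (take i w) * b (drop i w).

Definition brA (a b : word -> k) : word -> k :=
  fun w => convA a b w - convA b a w.

Definition convM (a : word -> k) (m : word * nat -> k) : word * nat -> k :=
  fun p => convA a (fun v => m (v, p.2)) p.1.

Inductive lie_elem (X : {fset nat}) : (word -> k) -> Prop :=
| le_gen x : x \in X -> lie_elem X (delta1 x)
| le_zero : lie_elem X (fun _ => 0)
| le_add a b : lie_elem X a -> lie_elem X b -> lie_elem X (fun w => a w + b w)
| le_opp a : lie_elem X a -> lie_elem X (fun w => - a w)
| le_scale c a : lie_elem X a -> lie_elem X (fun w => c * a w)
| le_br a b : lie_elem X a -> lie_elem X b -> lie_elem X (brA a b).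

Definition modelem (X Y : {fset nat}) (m : word * nat -> k) : Prop :=
  (forall w y, m (w, y) != 0 -> all (fun x => x \in X) w /\ y \in Y) /\
  (exists s : seq (word * nat), forall p, m p != 0 -> p \in s).

Lemma convA_supp a b w : convA a b w != 0 ->
  exists i, a (take i w) != 0 /\ b (drop i w) != 0.
Proof.
rewrite /convA.
case: (pickP (fun i : 'I_(size w).+1 => a (take i w) * b (drop i w) != 0)) => [i Hi|H0].
  by move=> _; exists i; move: Hi; rewrite mulf_eq0 negb_or => /andP[].
rewrite big1 ?eqxx // => i _; apply/eqP; by rewrite -[_ == 0]negbK H0.
Qed.

Lemma lie_fin X a : lie_elem X a ->
  (forall w, a w != 0 -> all (fun x => x \in X) w) /\
  (exists s : seq word, forall w, a w != 0 -> w \in s).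
Proof.
elim=> {a}.
- move=> x xX; split.
    move=> w; rewrite /delta1; case: (w =P [:: x]) => [-> _|_]; first by rewrite /= xX.
    by rewrite eqxx.
  exists [:: [:: x]] => w; rewrite /delta1; case: (w =P [:: x]) => [-> _|_].
    by rewrite inE.
  by rewrite eqxx.
- split; first by move=> w /=; rewrite eqxx.
  by exists [::] => w /=; rewrite eqxx.
- move=> a b _ [Ha [sa Hsa]] _ [Hb [sb Hsb]]; split.
    move=> w H; case: (a w =P 0) => [Ea|/eqP]; last exact: Ha.
    by apply: Hb; move: H; rewrite Ea add0r.
  exists (sa ++ sb) => w H; rewrite mem_cat.
  case: (a w =P 0) => [Ea|/eqP /Hsa ->] //.
  by rewrite Hsb ?orbT //; move: H; rewrite Ea add0r.
- move=> a _ [Ha [sa Hsa]]; split; first by move=> w; rewrite oppr_eq0; apply: Ha.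
  by exists sa => w; rewrite oppr_eq0; apply: Hsa.
- move=> c a _ [Ha [sa Hsa]]; split.
    by move=> w; rewrite mulf_eq0 negb_or => /andP[_]; apply: Ha.
  by exists sa => w; rewrite mulf_eq0 negb_or => /andP[_]; apply: Hsa.
- move=> a b _ [Ha [sa Hsa]] _ [Hb [sb Hsb]].
  have key : forall w, brA a b w != 0 ->
      exists i, (a (take i w) != 0 /\ b (drop i w) != 0) \/
                (b (take i w) != 0 /\ a (drop i w) != 0).
    move=> w; rewrite /brA.
    case: (convA a b w =P 0) => [->|/eqP /convA_supp [i Hi]]; last by exists i; left.
    rewrite sub0r oppr_eq0 => /convA_supp [i Hi]; by exists i; right.
  split.
    move=> w /key [i [[/Ha H1 /Hb H2] | [/Hb H1 /Ha H2]]];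
    by rewrite -(cat_take_drop i w) all_cat H1 H2.
  exists ([seq u ++ v | u <- sa, v <- sb] ++ [seq u ++ v | u <- sb, v <- sa]).
  move=> w /key [i [[/Hsa H1 /Hsb H2] | [/Hsb H1 /Hsa H2]]];
  rewrite -(cat_take_drop i w) mem_cat.
    by rewrite (allpairs_f (fun u v => u ++ v) H1 H2).
  by rewrite (allpairs_f (fun u v => u ++ v) H1 H2) orbT.
Qed.

Section FreeRep.
Variables X Y : {fset nat}.

Definition Lcar := {a : word -> k | lie_elem X a}.
Definition Lz : Lcar := exist _ _ (le_zero X).
Definition Ladd (a b : Lcar) : Lcar := exist _ _ (le_add (proj2_sig a) (proj2_sig b)).
Definition Lopp (a : Lcar) : Lcar := exist _ _ (le_opp (proj2_sig a)).
Definition Lsc (c : k) (a : Lcar) : Lcar := exist _ _ (le_scale c (proj2_sig a)).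
Definition Lbr (a b : Lcar) : Lcar := exist _ _ (le_br (proj2_sig a) (proj2_sig b)).

Definition freeLie : lieSig := @LieSig Lcar Lz Ladd Lopp Lsc Lbr.

Definition Vcar := {m : word * nat -> k | modelem X Y m}.

Lemma mod_zero : modelem X Y (fun _ => 0).
Proof. split; first by move=> w y /=; rewrite eqxx.
by exists [::] => p /=; rewrite eqxx. Qed.

Lemma mod_add m n : modelem X Y m -> modelem X Y n -> modelem X Y (fun p => m p + n p).
Proof.
move=> [Hm [sm Hsm]] [Hn [sn Hsn]]; split.
  move=> w y H; case: (m (w, y) =P 0) => [E|/eqP]; last exact: Hm.
  by apply: Hn; move: H; rewrite E add0r.
exists (sm ++ sn) => p H; rewrite mem_cat.
case: (m p =P 0) => [E|/eqP /Hsm ->] //.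
by rewrite Hsn ?orbT //; move: H; rewrite E add0r.
Qed.

Lemma mod_opp m : modelem X Y m -> modelem X Y (fun p => - m p).
Proof.
move=> [Hm [sm Hsm]]; split; first by move=> w y; rewrite oppr_eq0; apply: Hm.
by exists sm => p; rewrite oppr_eq0; apply: Hsm.
Qed.

Lemma mod_scale c m : modelem X Y m -> modelem X Y (fun p => c * m p).
Proof.
move=> [Hm [sm Hsm]]; split.
  by move=> w y; rewrite mulf_eq0 negb_or => /andP[_]; apply: Hm.
by exists sm => p; rewrite mulf_eq0 negb_or => /andP[_]; apply: Hsm.
Qed.

Lemma mod_act a m : lie_elem X a -> modelem X Y m -> modelem X Y (convM a m).
Proof.
move=> /lie_fin [Ha [sa Hsa]] [Hm [sm Hsm]]; split.
  move=> w y /convA_supp [i [/Ha H1 /Hm [H2 ->]]].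
  by rewrite -(cat_take_drop i w) all_cat H1 H2.
exists [seq (u ++ q.1, q.2) | u <- sa, q <- sm] => [[w y]] /convA_supp [i [/Hsa H1 /Hsm H2]].
rewrite -(cat_take_drop i w).
exact: (allpairs_f (fun u (q : word * nat) => (u ++ q.1, q.2)) H1 H2).
Qed.

Definition freeRep : repSig :=
  @RepSig freeLie Vcar
    (exist _ _ mod_zero)
    (fun m n => exist _ _ (mod_add (proj2_sig m) (proj2_sig n)))
    (fun m => exist _ _ (mod_opp (proj2_sig m)))
    (fun c m => exist _ _ (mod_scale c (proj2_sig m)))
    (fun a m => exist _ _ (mod_act (proj2_sig a) (proj2_sig m))).

End FreeRep.

Definition obj := ({fset nat} * {fset nat})%type.
Definition Wo (o : obj) : repSig := freeRep o.1 o.2.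

(* pairs of maps; morphisms of Xi^0 are those satisfying is_hom *)
Definition mor (H G : repSig) := ((rL H -> rL G) * (rV H -> rV G))%type.
Definition ishom (H G : repSig) (f : mor H G) := is_hom f.1 f.2.
Definition comp (A B C : repSig) (f : mor B C) (g : mor A B) : mor A C :=
  (f.1 \o g.1, f.2 \o g.2).
Definition idm (A : repSig) : mor A A := (id, id).

Definition cat_aut (Fo : obj -> obj)
    (Fm : forall o1 o2, mor (Wo o1) (Wo o2) -> mor (Wo (Fo o1)) (Wo (Fo o2))) : Prop :=
  [/\ bijective Fo,
      (forall o1 o2 f, ishom f -> ishom (Fm o1 o2 f)),
      (forall o1 o2 f g, ishom f -> ishom g -> Fm o1 o2 f = Fm o1 o2 g -> f = g),
      (forall o1 o2 g, ishom g -> exists f, ishom f /\ Fm o1 o2 f = g) &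
   [/\ (forall o1 o2 o3 (f : mor (Wo o2) (Wo o3)) (g : mor (Wo o1) (Wo o2)),
          ishom f -> ishom g -> Fm o1 o3 (comp f g) = comp (Fm o2 o3 f) (Fm o1 o2 g)) &
       (forall o, Fm o o (idm (Wo o)) = idm (Wo (Fo o)))]].

Definition pairs (o : obj) := ((rL (Wo o) -> Prop) * (rV (Wo o) -> Prop))%type.

Definition prime (H : repSig) (o : obj) (T : pairs o) (f : mor (Wo o) H) : Prop :=
  [/\ ishom f, (forall l, T.1 l -> f.1 l = lzero _) & (forall v, T.2 v -> f.2 v = vzero H)].

Definition dprime (H : repSig) (o : obj) (T : pairs o) : pairs o :=
  (fun l => forall f, @prime H o T f -> f.1 l = lzero _,
   fun v => forall f, @prime H o T f -> f.2 v = vzero H).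

Definition closed (H : repSig) (o : obj) (T : pairs o) : Prop := dprime H T = T.

Definition beta (o1 o2 : obj) (T : pairs o2) (f g : mor (Wo o1) (Wo o2)) : Prop :=
  [/\ ishom f, ishom g,
      (forall l, T.1 (ladd (f.1 l) (lopp (g.1 l)))) &
      (forall v, T.2 (vadd (f.2 v) (vopp (g.2 v))))].

Definition geom_equiv (H1 H2 : repSig) : Prop :=
  forall (o : obj) (T : pairs o), dprime H1 T = dprime H2 T.

Definition auto_equiv (H1 H2 : repSig) : Prop :=
  exists (Fo : obj -> obj)
         (Fm : forall o1 o2, mor (Wo o1) (Wo o2) -> mor (Wo (Fo o1)) (Wo (Fo o2))),
  cat_aut Fm /\
  exists alpha : forall o, pairs o -> pairs (Fo o),
    (forall o,
       [/\ (forall T, closed H1 T -> closed H2 (alpha o T)),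
           (forall T T', closed H1 T -> closed H1 T' -> alpha o T = alpha o T' -> T = T') &
           (forall S, closed H2 S -> exists T, closed H1 T /\ alpha o T = S)]) /\
    (forall (o1 o2 : obj) (T : pairs o2), closed H1 T ->
       forall f' g' : mor (Wo (Fo o1)) (Wo (Fo o2)),
         (exists f g, [/\ beta T f g, Fm o1 o2 f = f' & Fm o1 o2 g = g'])
         <-> beta (alpha o2 T) f' g').

End Reps.

(* Main.v *)
Require Import Defs.
From HB Require Import structures.
From Stdlib Require Import FunctionalExtensionality PropExtensionality.
From Stdlib Require Import ProofIrrelevance IndefiniteDescription.
From mathcomp Require Import all_boot all_algebra.
From mathcomp Require Import finmap.
From mathcomp Require Import ring.
Set Implicit Arguments. Unset Strict Implicit. Unset Printing Implicit Defensive.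
Import GRing.Theory Defs.
Local Open Scope ring_scope.

(** The two sorts are representable: L(o) = Hom(W({x},0), o) and
    V(o) = Hom(W(0,{y}), o).  Objects of this kind are the nonzero ones with
    commutative endomorphism monoid, so an automorphism F permutes them, and it
    cannot exchange the two kinds, since otherwise brackets in L(F o) would be
    given by a natural operation a v1 + b v2 on V(o), which must vanish.  Hence F
    induces natural bijections sL : L(o) -> L(F o) and sV : V(o) -> V(F o).
    Naturality turns each operation transported back along sL, sV into a fixed
    element of a free object.  On V this makes sV additive and semilinear for an
    automorphism of k, hence linear.  For the action it gives a polynomial q with
    sL(l) sV(v) = sV(q(l) v); compatibility with scalars leaves only a monomial
    a l^i, and the sum sL(x0) + sL(x1) = sL(w) forces w^i = x0^i + x1^i in the free
    associative algebra, so i = 1.  As L acts faithfully on free modules, sL is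
    then linear with sL(a [l1,l2]) = [sL l1, sL l2], and (a^-1 sL, sV) is an
    isomorphism W(o) -> W(F o).  Finally beta determines alpha T = (sL T, sV T), so
    H1 and H2 have the same closed sets, which is geometric equivalence. *)

(** * Coefficients in the free representation *)

Section Free.
Variable k : fieldType.

(** * Convolution product and Lie elements *)

Section Conv.
Implicit Types a b c : word -> k.

Lemma convA_nil a b : convA a b [::] = a [::] * b [::].
Proof. by rewrite /convA big_ord1. Qed.

Lemma convA_cons a b x w :
  convA a b (x :: w) = a [::] * b (x :: w) + convA (fun v => a (x :: v)) b w.
Proof. by rewrite /convA big_ord_recl /=; congr (_ + _); apply: eq_bigr. Qed.

Lemma eq_convA a a' b b' : a =1 a' -> b =1 b' -> convA a b =1 convA a' b'.
Proof. by move=> Ea Eb w; apply: eq_bigr => i _; rewrite Ea Eb. Qed.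

Lemma convADl a a' b w : convA (fun v => a v + a' v) b w = convA a b w + convA a' b w.
Proof. by rewrite -big_split; apply: eq_bigr => i _; rewrite mulrDl. Qed.

Lemma convAZl z a b w : convA (fun v => z * a v) b w = z * convA a b w.
Proof. by rewrite mulr_sumr; apply: eq_bigr => i _; rewrite mulrA. Qed.

Lemma convAZr z a b w : convA a (fun v => z * b v) w = z * convA a b w.
Proof. by rewrite mulr_sumr; apply: eq_bigr => i _; rewrite mulrCA. Qed.

Lemma convANl a b w : convA (fun v => - a v) b w = - convA a b w.
Proof. by rewrite -mulN1r -convAZl; apply: eq_convA => // v; rewrite mulN1r. Qed.

Lemma convABl a a' b w : convA (fun v => a v - a' v) b w = convA a b w - convA a' b w.
Proof. by rewrite convADl convANl. Qed.

Lemma convA0r a w : convA a (fun _ => 0) w = 0.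
Proof. by apply: big1 => i _; rewrite mulr0. Qed.

Lemma convA0l b w : convA (fun _ => 0) b w = 0.
Proof. by apply: big1 => i _; rewrite mul0r. Qed.

Lemma convA_sumr a (N : nat) (b : nat -> word -> k) w :
  convA a (fun v => \sum_(j < N) b j v) w = \sum_(j < N) convA a (b j) w.
Proof.
by rewrite exchange_big; apply: eq_bigr => i _; rewrite mulr_sumr.
Qed.

(** Peeling off the first letter replaces the left factor by its shift [fun v => a (x :: v)]; the
    induction therefore generalises over [a] and [b]. *)
Lemma convA_assoc a b c w : convA (convA a b) c w = convA a (convA b c) w.
Proof.
elim: w a b => [|x w IH] a b; first by rewrite !convA_nil mulrA.
rewrite !convA_cons convA_nil -IH mulrDr -!addrA mulrA; congr (_ + _).
rewrite -convAZl -convADl; apply: eq_convA => // v.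
by rewrite convA_cons.
Qed.

Lemma convA_delta x b w :
  convA (delta1 k x) b w = if w is z :: w' then (z == x)%:R * b w' else 0.
Proof.
case: w => [|z w]; first by rewrite convA_nil /delta1 mul0r.
rewrite convA_cons {1}/delta1 mul0r add0r.
case: w => [|z' w].
  by rewrite convA_nil /delta1 eqseq_cons andbT.
rewrite convA_cons {1}/delta1 eqseq_cons andbT [X in _ + X](_ : _ = 0) ?addr0 //.
apply: big1 => i _; rewrite /delta1 (_ : _ == _ = false) ?mul0r //.
by rewrite eqseq_cons andbF.
Qed.

Lemma lie_nil X a : lie_elem X a -> a [::] = 0.
Proof.
elim=> //= [a' b' _ -> _ ->|a' _ ->|z a' _ ->|a' b' _ Ha _ Hb].
- by rewrite ?addr0.
- by rewrite oppr0.
- by rewrite mulr0.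
- by rewrite /brA !convA_nil Ha Hb mulr0 subr0.
Qed.

Lemma convA_letter a b x :
  a [::] = 0 -> convA a b [:: x] = a [:: x] * b [::].
Proof. by move=> Ha; rewrite convA_cons convA_nil Ha mul0r add0r. Qed.

Lemma brA_letter X a b x : lie_elem X a -> lie_elem X b -> brA a b [:: x] = 0.
Proof.
move=> /lie_nil Ha /lie_nil Hb.
by rewrite /brA !convA_letter // Ha Hb !mulr0 subr0.
Qed.

(** Brackets of multiples of the same letter vanish, so the free Lie algebra on one generator is a
    line. *)
Lemma lie_single x a : lie_elem [fset x]%fset a ->
  forall w, a w = a [:: x] * delta1 k x w.
Proof.
elim=> {a}.
- by move=> z /fset1P -> w; rewrite {2}/delta1 eqxx mul1r.
- by move=> w; rewrite mul0r.
- by move=> a b _ Ha _ Hb w; rewrite Ha Hb mulrDl.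
- by move=> a _ Ha w; rewrite Ha mulNr.
- by move=> z a _ Ha w; rewrite Ha mulrA.
- move=> a b La Ha Lb Hb w; rewrite (brA_letter _ La Lb) mul0r.
  rewrite /brA (eq_convA Ha Hb) (eq_convA Hb Ha) !(convAZl, convAZr) mulrCA.
  by rewrite subrr.
Qed.

Lemma lie_empty a : lie_elem fset0 a -> forall w, a w = 0.
Proof.
elim=> {a} //.
- by move=> a b _ Ha _ Hb w; rewrite Ha Hb addr0.
- by move=> a _ Ha w; rewrite Ha oppr0.
- by move=> z a _ Ha w; rewrite Ha mulr0.
- by move=> a b _ Ha _ Hb w; rewrite /brA /convA !big1 ?subr0 // => i _;
    rewrite Ha Hb mul0r.
Qed.

End Conv.

(** * Coordinates and generators of free representations *)

Definition cL (o : obj) (l : rL (Wo k o)) : word -> k := proj1_sig l.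
Definition cV (o : obj) (v : rV (Wo k o)) : word * nat -> k := proj1_sig v.

Lemma cL_inj o (l l' : rL (Wo k o)) : cL l =1 cL l' -> l = l'.
Proof.
case: l l' => a Ha [b Hb] /= E.
have {}E : a = b by apply: functional_extensionality.
by subst b; rewrite (proof_irrelevance _ Ha Hb).
Qed.

Lemma cV_inj o (v v' : rV (Wo k o)) : cV v =1 cV v' -> v = v'.
Proof.
case: v v' => a Ha [b Hb] /= E.
have {}E : a = b by apply: functional_extensionality.
by subst b; rewrite (proof_irrelevance _ Ha Hb).
Qed.

Lemma cLD o (l l' : rL (Wo k o)) w : cL (ladd l l') w = cL l w + cL l' w.
Proof. by []. Qed.
Lemma cLZ o z (l : rL (Wo k o)) w : cL (lscale z l) w = z * cL l w.
Proof. by []. Qed.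
Lemma cLN o (l : rL (Wo k o)) w : cL (lopp l) w = - cL l w.
Proof. by []. Qed.
Lemma cL0 o w : cL (lzero (rL (Wo k o))) w = 0.
Proof. by []. Qed.
Lemma cLB o (l l' : rL (Wo k o)) w : cL (lbr l l') w = brA (cL l) (cL l') w.
Proof. by []. Qed.
Lemma cVD o (v v' : rV (Wo k o)) p : cV (vadd v v') p = cV v p + cV v' p.
Proof. by []. Qed.
Lemma cVZ o z (v : rV (Wo k o)) p : cV (vscale z v) p = z * cV v p.
Proof. by []. Qed.
Lemma cVN o (v : rV (Wo k o)) p : cV (vopp v) p = - cV v p.
Proof. by []. Qed.
Lemma cV0 o p : cV (vzero (Wo k o)) p = 0.
Proof. by []. Qed.
Lemma cVM o (l : rL (Wo k o)) (v : rV (Wo k o)) w y :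
  cV (ract l v) (w, y) = convA (cL l) (fun u => cV v (u, y)) w.
Proof. by []. Qed.
Definition free_coefE := (cLD, cLZ, cLN, cL0, cLB, cVD, cVZ, cVN, cV0, cVM).

Lemma cL_nil o (l : rL (Wo k o)) : cL l [::] = 0.
Proof. exact: lie_nil (proj2_sig l). Qed.

Lemma cL_br_letter o (l l' : rL (Wo k o)) x : cL (lbr l l') [:: x] = 0.
Proof. exact: brA_letter (proj2_sig l) (proj2_sig l'). Qed.

Lemma cV_act_nil o (l : rL (Wo k o)) (v : rV (Wo k o)) y : cV (ract l v) ([::], y) = 0.
Proof. by rewrite cVM convA_nil cL_nil mul0r. Qed.

Lemma cV_out o (v : rV (Wo k o)) w y :
  ~~ (all (fun x => x \in o.1) w && (y \in o.2)) -> cV v (w, y) = 0.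
Proof.
move=> H; apply/eqP; apply: contraNT H => H.
by have [-> ->] := (proj2_sig v).1 w y H.
Qed.

Lemma modelem_gen (X Y : {fset nat}) y :
  y \in Y -> modelem X Y (fun p => (p == ([::], y))%:R : k).
Proof.
move=> yY; split.
  by move=> w z /=; case: ((w, z) =P ([::], y)) => [[-> ->] _|_] //=; rewrite eqxx.
by exists [:: ([::], y)] => p; rewrite inE; case: (p =P _) => // _; rewrite eqxx.
Qed.

Definition genL (o : obj) x (xX : x \in o.1) : rL (Wo k o) :=
  exist _ _ (le_gen k xX).
Definition genV (o : obj) y (yY : y \in o.2) : rV (Wo k o) :=
  exist _ _ (modelem_gen o.1 yY).

Lemma cL_gen o x (xX : x \in o.1) w : cL (genL xX) w = (w == [:: x])%:R.
Proof. by []. Qed.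
Lemma cV_gen o y (yY : y \in o.2) p : cV (genV yY) p = (p == ([::], y))%:R.
Proof. by []. Qed.

Lemma cL_single x (o : obj) (l : rL (Wo k o)) : o.1 = [fset x]%fset ->
  forall w, cL l w = cL l [:: x] * (w == [:: x])%:R.
Proof. by move=> Ho; apply: lie_single; rewrite -Ho; apply: (proj2_sig l). Qed.

Lemma cL_empty (o : obj) (l : rL (Wo k o)) : o.1 = fset0 -> forall w, cL l w = 0.
Proof. by move=> Ho; apply: lie_empty; rewrite -Ho; apply: (proj2_sig l). Qed.

Lemma cV_single y (o : obj) (v : rV (Wo k o)) : o.1 = fset0 -> o.2 = [fset y]%fset ->
  forall p, cV v p = cV v ([::], y) * (p == ([::], y))%:R.
Proof.
move=> H1 H2 [w z]; case: eqP => [-> |H]; rewrite ?mulr1 // mulr0.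
apply: cV_out; apply/negP; rewrite H1 H2 => /andP[Hw /fset1P Hz].
by case: w H Hw => //; rewrite Hz.
Qed.

Lemma cV_empty (o : obj) (v : rV (Wo k o)) : o.2 = fset0 -> forall p, cV v p = 0.
Proof. by move=> H2 [w z]; apply: cV_out; rewrite H2 andbF. Qed.

(* A homomorphism for every p: Lie elements have no constant term and brackets no
   linear term. *)
Definition eltL (p : obj) (x : nat) (o : obj) (l : rL (Wo k o)) : mor (Wo k p) (Wo k o) :=
  (fun a : rL (Wo k p) => lscale (cL a [:: x]) l, fun _ => vzero (Wo k o)).

Definition eltV (p : obj) (y : nat) (o : obj) (v : rV (Wo k o)) : mor (Wo k p) (Wo k o) :=
  (fun _ => lzero (rL (Wo k o)), fun m : rV (Wo k p) => vscale (cV m ([::], y)) v).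

(** For distinct generators [y] and [z] of [p] this sends [y] to [u] and [z] to [v]; it serves to
    evaluate binary operations on the module sort. *)
Definition eltV2 (p : obj) (y z : nat) (o : obj) (u v : rV (Wo k o)) : mor (Wo k p) (Wo k o) :=
  (fun _ => lzero (rL (Wo k o)),
   fun m : rV (Wo k p) => vadd (vscale (cV m ([::], y)) u) (vscale (cV m ([::], z)) v)).

Lemma eltLE p x o l a : (@eltL p x o l).1 a = lscale (cL a [:: x]) l.
Proof. by []. Qed.
Lemma eltLE2 p x o l m : (@eltL p x o l).2 m = vzero (Wo k o).
Proof. by []. Qed.
Lemma eltVE1 p y o v a : (@eltV p y o v).1 a = lzero (rL (Wo k o)).
Proof. by []. Qed.
Lemma eltVE p y o v m : (@eltV p y o v).2 m = vscale (cV m ([::], y)) v.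
Proof. by []. Qed.
Lemma eltV2E1 p y z o u v a : (@eltV2 p y z o u v).1 a = lzero (rL (Wo k o)).
Proof. by []. Qed.
Lemma eltV2E p y z o u v m : (@eltV2 p y z o u v).2 m =
  vadd (vscale (cV m ([::], y)) u) (vscale (cV m ([::], z)) v).
Proof. by []. Qed.

Definition eltE := (eltLE, eltLE2, eltVE1, eltVE, eltV2E1, eltV2E).

Lemma eltL_hom p x o l : ishom (@eltL p x o l).
Proof.
split; [..|split] => *; try (apply: cL_inj => w); try (apply: cV_inj => -[w z]);
  rewrite !eltE ?cL_br_letter ?free_coefE ?convA0r; try ring.
by rewrite /brA !(convAZl, convAZr) mul0r mulrCA subrr.
Qed.

Lemma eltV_hom p y o v : ishom (@eltV p y o v).
Proof.
split; [..|split] => *; try (apply: cL_inj => w); try (apply: cV_inj => -[w z]);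
  rewrite !eltE ?cV_act_nil ?free_coefE /brA ?convA0l; try ring.
Qed.

Lemma eltV2_hom p y z o u v : ishom (@eltV2 p y z o u v).
Proof.
split; [..|split] => *; try (apply: cL_inj => w'); try (apply: cV_inj => -[w' z']);
  rewrite !eltE ?cV_act_nil ?free_coefE /brA ?convA0l; try ring.
Qed.

Lemma id_hom o : ishom (idm (Wo k o)).
Proof. by split; [..|split]. Qed.

Lemma comp_hom (A B C : repSig k) (f : mor B C) (g : mor A B) :
  ishom f -> ishom g -> ishom (comp f g).
Proof.
move=> [f1 f2 f3 f4 [f5 f6]] [g1 g2 g3 g4 [g5 g6]]; split; [..|split] => *;
by rewrite /= ?(g1, g2, g3, g4, g5, f1, f2, f3, f4, f5, f6) -?g6.
Qed.

Section LieHom.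
Variables (X Y Y' : {fset nat}).
(** Changes the module generators while keeping every Lie element. *)
Definition lie_hom : mor (Wo k (X, Y)) (Wo k (X, Y')) :=
  (id, fun _ => vzero (Wo k (X, Y'))).

Lemma lie_homP : ishom lie_hom.
Proof.
have E u q : cV (lie_hom.2 u) q = 0 by [].
split=> //; last split; move=> *; apply: cV_inj => -[w z]; rewrite ?free_coefE ?E.
- by rewrite ?addr0.
- by rewrite mulr0.
- by rewrite (eq_convA (frefl _) (fun u => E _ _)) convA0r.
Qed.
End LieHom.

(* The homomorphism W({x},{y}) -> W(o) with x |-> l, y |-> v.  As l^j v has no word
   shorter than j, the sum over j may be truncated at the length of the word. *)
Section OneVar.
Variables (o : obj) (l : rL (Wo k o)) (v : rV (Wo k o)).

Definition iter_act j := iter j (ract l) v.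

Lemma iter_actS j : iter_act j.+1 = ract l (iter_act j).
Proof. by []. Qed.

Lemma iter_act_small j w y : (size w < j)%N -> cV (iter_act j) (w, y) = 0.
Proof.
elim: j w => [|j IH] [|x w] // H; rewrite iter_actS ?cV_act_nil // cVM.
rewrite convA_cons cL_nil mul0r add0r.
apply: big1 => i _; rewrite IH ?mulr0 // size_drop.
by apply: leq_ltn_trans (leq_subr _ _) _.
Qed.

Definition subst1_fun (x y : nat) (m : word * nat -> k) : word * nat -> k :=
  fun p => \sum_(j < (size p.1).+1) m (nseq j x, y) * cV (iter_act j) p.

Lemma modelem_bound (X Y : {fset nat}) (m : word * nat -> k) : modelem X Y m ->
  exists N, forall j x y, (N <= j)%N -> m (nseq j x, y) = 0.
Proof.
move=> [_ [s Hs]]; exists (\max_(p <- s) (size p.1)).+1 => j x y Hj.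
apply/eqP; apply: contraTT Hj => /Hs H; rewrite -ltnNge ltnS.
rewrite -[X in (X <= _)%N](size_nseq j x).
exact: (@leq_bigmax_seq (seq nat * nat)%type s xpredT (fun p => size p.1) _ H isT).
Qed.

(** Replaces the truncation depending on the word by a uniform one: the extra terms vanish through
    [m] when [j >= N], and through [iter_act] when [j] exceeds the length of the word. *)
Lemma subst1E (x y : nat) (m : word * nat -> k) N : (forall j, (N <= j)%N -> m (nseq j x, y) = 0) ->
  forall p, subst1_fun x y m p = \sum_(j < N) m (nseq j x, y) * cV (iter_act j) p.
Proof.
move=> HN [w z]; rewrite /subst1_fun /=.
pose F j := m (nseq j x, y) * cV (iter_act j) (w, z).
rewrite -!(big_mkord xpredT F).
have E M M' : (M <= M')%N -> (forall j, (M <= j)%N -> F j = 0) ->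
    \sum_(0 <= j < M) F j = \sum_(0 <= j < M') F j.
  move=> le HF; rewrite [RHS](big_cat_nat (leq0n M) le) //= [X in _ + X]big_nat_cond.
  by rewrite [X in _ + X]big1 ?addr0 // => j /andP[/andP[/HF]].
have [le|/ltnW le] := leqP N (size w).+1.
  by rewrite -(E _ _ le) // => j /HN; rewrite /F => ->; rewrite mul0r.
by rewrite -(E _ _ le) // => j Hj; rewrite /F iter_act_small ?mulr0.
Qed.

Lemma subst1_modelem x y (X Y : {fset nat}) (m : word * nat -> k) :
  modelem X Y m -> modelem o.1 o.2 (subst1_fun x y m).
Proof.
move=> /modelem_bound [N HN].
have -> : subst1_fun x y m = (fun p => \sum_(j < N) m (nseq j x, y) * cV (iter_act j) p).
  by apply: functional_extensionality; apply: subst1E => j; apply: HN.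
elim: N {HN} => [|N IH].
  have -> : (fun p => \sum_(j < 0) m (nseq j x, y) * cV (iter_act j) p) = (fun _ => 0).
    by apply: functional_extensionality => p; rewrite big_ord0.
  exact: mod_zero.
have -> : (fun p => \sum_(j < N.+1) m (nseq j x, y) * cV (iter_act j) p) =
          (fun p => \sum_(j < N) m (nseq j x, y) * cV (iter_act j) p
                    + m (nseq N x, y) * cV (iter_act N) p).
  by apply: functional_extensionality => p; rewrite big_ord_recr.
by apply: mod_add => //; apply: mod_scale; apply: (proj2_sig (iter_act N)).
Qed.

Variables (p : obj) (x y : nat).

Definition subst1 : mor (Wo k p) (Wo k o) :=
  (fun a : rL (Wo k p) => lscale (cL a [:: x]) l,
   fun m : rV (Wo k p) =>
     exist _ _ (subst1_modelem x y (proj2_sig m)) : rV (Wo k o)).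

Lemma subst1_L a : subst1.1 a = lscale (cL a [:: x]) l.
Proof. by []. Qed.
Lemma subst1_V m q : cV (subst1.2 m) q = subst1_fun x y (cV m) q.
Proof. by []. Qed.

(** Over the single letter [x], acting by [a] is a multiple of the shift from degree [j] to degree
    [j.+1], and [ract l] shifts [iter_act] in the same way. *)
Lemma subst1_hom : p.1 = [fset x]%fset -> ishom subst1.
Proof.
move=> px; have [h1 h2 h3 _ _] := eltL_hom p x l.
split=> //; last split.
- move=> u u'; apply: cV_inj => q; rewrite !(subst1_V, free_coefE) -big_split.
  by apply: eq_bigr => j _; rewrite free_coefE mulrDl.
- move=> c u; apply: cV_inj => q; rewrite !(subst1_V, free_coefE) mulr_sumr.
  by apply: eq_bigr => j _; rewrite free_coefE mulrA.
- move=> a m; apply: cV_inj => -[w z]; rewrite subst1_V cVM subst1_L.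
  have [N HN] : exists N, forall j x y, (N <= j)%N -> cV m (nseq j x, y) = 0.
    exact: modelem_bound (proj2_sig m).
  have Ea j : cV (ract a m) (nseq j.+1 x, y) = cL a [:: x] * cV m (nseq j x, y).
    rewrite cVM (eq_convA (cL_single a px) (frefl _)) convAZl.
    by rewrite -/(delta1 k x) convA_delta /= eqxx mul1r.
  (* The action raises degrees by one, so the bound for [ract a m] is one more than that for [m]. *)
  rewrite (@subst1E _ _ _ N.+1); last first.
    by move=> [|j] // Hj; rewrite Ea (HN j x y) ?mulr0.
  rewrite big_ord_recl cV_act_nil mul0r add0r.
  have E u : cV (subst1.2 m) (u, z) = \sum_(j < N) cV m (nseq j x, y) * cV (iter_act j) (u, z).
    by rewrite subst1_V; apply: subst1E => j; apply: HN.
  rewrite (eq_convA (frefl _) E).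
  rewrite (@convA_sumr _ _ (fun j u => cV m (nseq j x, y) * cV (iter_act j) (u, z))).
  apply: eq_bigr => j _.
  rewrite convAZr lift0 Ea iter_actS cVM -mulrA mulrCA; congr (_ * _).
  by rewrite -convAZl.
Qed.
End OneVar.
End Free.

(** * Objects representing the two sorts *)

Section Points.
Variable k : fieldType.

Lemma mor_ext (H G : repSig k) (f g : mor H G) : f.1 =1 g.1 -> f.2 =1 g.2 -> f = g.
Proof.
case: f g => [f1 f2] [g1 g2] /= E1 E2.
by congr pair; apply: functional_extensionality.
Qed.

(* [true] stands for the Lie algebra sort, [false] for the module sort. *)
Definition sort_of (b : bool) (H : repSig k) : Type := if b then lcar (rL H) else rV H.

Definition mor_on (b : bool) (H G : repSig k) (f : mor H G) : sort_of b H -> sort_of b G :=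
  match b as b0 return sort_of b0 H -> sort_of b0 G with true => f.1 | false => f.2 end.

Arguments mor_on b {H G} f _.

Definition zero_on (b : bool) (H : repSig k) : sort_of b H :=
  match b as b0 return sort_of b0 H with true => lzero (rL H) | false => vzero H end.

Lemma mor_on_comp b (A B C : repSig k) (f : mor B C) (g : mor A B) z :
  mor_on b (comp f g) z = mor_on b f (mor_on b g z).
Proof. by case: b z. Qed.

Lemma mor_on_id b (A : repSig k) (z : sort_of b A) : mor_on b (idm A) z = z.
Proof. by case: b z. Qed.

Definition zhom (o o' : obj) : mor (Wo k o) (Wo k o') :=
  (fun _ => lzero (rL (Wo k o')), fun _ => vzero (Wo k o')).

Lemma zhomE o o' : zhom o o' = eltL o 0%N (lzero (rL (Wo k o'))).
Proof.
by apply: mor_ext => // a; apply: cL_inj => w; rewrite eltLE !free_coefE mulr0.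
Qed.

Lemma zhom_hom o o' : ishom (zhom o o').
Proof. rewrite zhomE; exact: eltL_hom. Qed.

(** [is_hom] does not list zero; it is preserved as the scalar multiple by 0. *)
Lemma hom_zero_on b o o' (f : mor (Wo k o) (Wo k o')) : ishom f ->
  mor_on b f (zero_on b _) = zero_on b _.
Proof.
case=> _ hL _ _ [hV _]; case: b; rewrite /mor_on /zero_on.
- have -> : lzero (rL (Wo k o)) = lscale 0 (lzero (rL (Wo k o))).
    by apply: cL_inj => w; rewrite !free_coefE mul0r.
  by rewrite hL; apply: cL_inj => w; rewrite !free_coefE mul0r.
- have -> : vzero (Wo k o) = vscale 0 (vzero (Wo k o)).
    by apply: cV_inj => w; rewrite !free_coefE mul0r.
  by rewrite hV; apply: cV_inj => w; rewrite !free_coefE mul0r.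
Qed.

(* Every hom out of p is determined by the image of a universal element [re_u], which
   is arbitrary: p represents the functor of elements of sort b. *)
Record rep_elem (b : bool) (p : obj) := RepElem {
  re_u : sort_of b (Wo k p);
  re_e : forall o, sort_of b (Wo k o) -> mor (Wo k p) (Wo k o);
  re_hom : forall o z, ishom (@re_e o z);
  re_e_u : forall o z, mor_on b (@re_e o z) re_u = z;
  re_uniq : forall o f, ishom f -> f = @re_e o (mor_on b f re_u) }.

Section PointL.
Variables (p : obj) (x : nat).
Hypotheses (xp : x \in p.1) (px : p.1 = [fset x]%fset) (p0 : p.2 = fset0).

Lemma pointL_uniq o (f : mor (Wo k p) (Wo k o)) :
  ishom f -> f = eltL p x (mor_on true f (genL k xp)).
Proof.
move=> hf; have f0 := hom_zero_on false hf; case: hf => _ hL _ _ _.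
apply: mor_ext => a; rewrite eltE.
  rewrite /mor_on -hL; congr (f.1 _); apply: cL_inj => w.
  by rewrite free_coefE cL_gen (cL_single _ px).
rewrite -[RHS]f0; congr (f.2 _); apply: cV_inj => q.
by rewrite (cV_empty _ p0) free_coefE.
Qed.

Lemma pointL_u o (z : rL (Wo k o)) : mor_on true (eltL p x z) (genL k xp) = z.
Proof. by apply: cL_inj => w; rewrite /mor_on eltLE !free_coefE cL_gen eqxx mul1r. Qed.

Definition pointL : rep_elem true p :=
  @RepElem true p (genL k xp) (eltL p x) (eltL_hom p x) pointL_u pointL_uniq.
End PointL.

Section PointV.
Variables (p : obj) (y : nat).
Hypotheses (yp : y \in p.2) (p0 : p.1 = fset0) (py : p.2 = [fset y]%fset).

Lemma pointV_uniq o (f : mor (Wo k p) (Wo k o)) :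
  ishom f -> f = eltV p y (mor_on false f (genV k yp)).
Proof.
move=> hf; have f0 := hom_zero_on true hf; case: hf => _ _ _ _ [hV _].
apply: mor_ext => a; rewrite eltE.
  rewrite -[RHS]f0; congr (f.1 _); apply: cL_inj => q.
  by rewrite (cL_empty _ p0) free_coefE.
rewrite /mor_on -hV; congr (f.2 _); apply: cV_inj => w.
by rewrite free_coefE cV_gen (cV_single _ p0 py).
Qed.

Lemma pointV_u o (z : rV (Wo k o)) : mor_on false (eltV p y z) (genV k yp) = z.
Proof. by apply: cV_inj => w; rewrite /mor_on eltVE !free_coefE cV_gen eqxx mul1r. Qed.

Definition pointV : rep_elem false p :=
  @RepElem false p (genV k yp) (eltV p y) (eltV_hom p y) pointV_u pointV_uniq.
End PointV.

Definition PL (x : nat) : obj := ([fset x], fset0)%fset.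
Definition PV (y : nat) : obj := (fset0, [fset y])%fset.

Definition repL x : rep_elem true (PL x) :=
  @pointL (PL x) x (fset11 x) erefl erefl.
Definition repV y : rep_elem false (PV y) :=
  @pointV (PV y) y (fset11 y) erefl erefl.

(** A categorical property, hence preserved by automorphisms; among nonzero objects it singles out
    the [PL x] and [PV y]. *)
Definition comm_end o := forall f g : mor (Wo k o) (Wo k o),
  ishom f -> ishom g -> comp f g = comp g f.

(** The Lie sort of [PL x] is a line, on which endomorphisms are scalars. *)
Lemma comm_pointL (x : nat) : comm_end (PL x).
Proof.
pose r := repL x.
move=> f g hf hg; have hfg := comp_hom hf hg; have hgf := comp_hom hg hf.
rewrite (re_uniq r hfg) (re_uniq r hgf); congr (re_e _ _).
have px : (PL x).1 = [fset x]%fset by [].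
have E (h : mor (Wo k (PL x)) (Wo k (PL x))) : ishom h ->
    exists c, forall a, h.1 a = lscale c a.
  move=> hh; pose u : rL (Wo k (PL x)) := mor_on true h (re_u r); exists (cL u [:: x]) => a.
  transitivity ((eltL (PL x) x u).1 a).
    exact: (congr1 (fun h : mor _ _ => h.1 a) (re_uniq r hh)).
  rewrite eltLE; apply: cL_inj => w.
  by rewrite !free_coefE [cL a w](cL_single a px) [cL u w](cL_single u px) mulrCA.
have [c Ec] := E _ hf; have [d Ed] := E _ hg.
have EE a : f.1 (g.1 a) = g.1 (f.1 a).
  by rewrite Ec !Ed Ec; apply: cL_inj => w; rewrite !free_coefE mulrCA.
exact: EE.
Qed.

Lemma comm_pointV (y : nat) : comm_end (PV y).
Proof.
pose r := repV y.
move=> f g hf hg; have hfg := comp_hom hf hg; have hgf := comp_hom hg hf.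
rewrite (re_uniq r hfg) (re_uniq r hgf); congr (re_e _ _).
have py : (PV y).2 = [fset y]%fset by [].
have p0 : (PV y).1 = fset0 by [].
have E (h : mor (Wo k (PV y)) (Wo k (PV y))) : ishom h ->
    exists c, forall a, h.2 a = vscale c a.
  move=> hh; pose u : rV (Wo k (PV y)) := mor_on false h (re_u r); exists (cV u ([::], y)) => a.
  transitivity ((eltV (PV y) y u).2 a).
    exact: (congr1 (fun h : mor _ _ => h.2 a) (re_uniq r hh)).
  rewrite eltVE; apply: cV_inj => w.
  by rewrite !free_coefE [cV a w](cV_single a p0 py) [cV u w](cV_single u p0 py) mulrCA.
have [c Ec] := E _ hf; have [d Ed] := E _ hg.
have EE a : f.2 (g.2 a) = g.2 (f.2 a).
  by rewrite Ec !Ed Ec; apply: cV_inj => w; rewrite !free_coefE mulrCA.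
exact: EE.
Qed.

Lemma comp_eqL (A B B' C : repSig k) (a : rL A) (f : mor B C) (g : mor A B)
  (f' : mor B' C) (g' : mor A B') :
  comp f g = comp f' g' -> f.1 (g.1 a) = f'.1 (g'.1 a).
Proof. by move=> E; apply: (congr1 (fun h : mor _ _ => h.1 a) E). Qed.

Lemma comp_eqV (A B B' C : repSig k) (a : rV A) (f : mor B C) (g : mor A B)
  (f' : mor B' C) (g' : mor A B') :
  comp f g = comp f' g' -> f.2 (g.2 a) = f'.2 (g'.2 a).
Proof. by move=> E; apply: (congr1 (fun h : mor _ _ => h.2 a) E). Qed.

(** Two distinct generators x, x' of one sort give the non-commuting maps x |-> x' and x |-> x, zero
    on the other generators; generators x, y of different sorts give y |-> y and y |-> x y. So there
    is at most one generator, and the second hypothesis excludes that there is none. *)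
Lemma comm_end_point o : comm_end o -> idm (Wo k o) <> zhom o o ->
  (exists x, o = PL x) \/ (exists y, o = PV y).
Proof.
move=> Hc Hid.
have HX x x' : x \in o.1 -> x' \in o.1 -> x = x'.
  move=> xo xo'; apply/eqP; apply/negP => /negP ne.
  have /(comp_eqL (genL k xo))/(congr1 (fun a => cL a [:: x'])) :=
    Hc _ _ (eltL_hom o x (genL k xo')) (eltL_hom o x (genL k xo)).
  rewrite !eltLE !free_coefE !cL_gen !eqxx !eqseq_cons !andbT.
  rewrite (negbTE ne) eq_sym (negbTE ne) !mul1r !mul0r => /eqP.
  by rewrite oner_eq0.
have HY y y' : y \in o.2 -> y' \in o.2 -> y = y'.
  move=> yo yo'; apply/eqP; apply/negP => /negP ne.
  have /(comp_eqV (genV k yo))/(congr1 (fun a => cV a ([::], y'))) :=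
    Hc _ _ (eltV_hom o y (genV k yo')) (eltV_hom o y (genV k yo)).
  rewrite !eltVE !free_coefE !cV_gen !eqxx !xpair_eqE !eqxx /=.
  rewrite (negbTE ne) eq_sym (negbTE ne) !mul1r !mul0r => /eqP.
  by rewrite oner_eq0.
have HXY x y : x \in o.1 -> y \in o.2 -> False.
  move=> xo yo.
  have /(comp_eqV (genV k yo))/(congr1 (fun a => cV a ([:: x], y))) :=
    Hc _ _ (eltV_hom o y (genV k yo)) (eltV_hom o y (ract (genL k xo) (genV k yo))).
  rewrite !eltVE !cVZ cV_act_nil !cV_gen !eqxx ?mulr0 ?mul0r ?mul1r cVM.
  rewrite convA_letter ?cL_nil // cL_gen cV_gen !eqxx mul1r => /esym/eqP.
  by rewrite oner_eq0.
case: o Hc Hid HX HY HXY => X Y /= Hc Hid HX HY HXY.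
have [EX|[x xX]] := fset_0Vmem X; have [EY|[y yY]] := fset_0Vmem Y.
- case: Hid; apply: mor_ext => a.
    by apply: cL_inj => w; rewrite !(cL_empty _ (o := (X, Y)) EX).
  by apply: cV_inj => w; rewrite !(cV_empty _ (o := (X, Y)) EY).
- right; exists y; rewrite EX; congr pair; apply/fsetP => z.
  by apply/idP/fset1P => [/HY/(_ yY)|->].
- left; exists x; rewrite EY; congr pair; apply/fsetP => z.
  by apply/idP/fset1P => [/HX/(_ xX)|->].
- by case: (HXY x y).
Qed.
End Points.

Arguments mor_on {k} b {H G} f _.
Arguments re_u {k b p} r.
Arguments re_e {k b p} r {o} z.
Arguments re_hom {k b p} r {o} z.
Arguments re_e_u {k b p} r {o} z.
Arguments re_uniq {k b p} r {o f}.

(** * Automorphisms of the category *)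

Section Transport.
Variable k : fieldType.
Variables (Fo : obj -> obj)
  (Fm : forall o1 o2, mor (Wo k o1) (Wo k o2) -> mor (Wo k (Fo o1)) (Wo k (Fo o2))).
Hypothesis HF : cat_aut Fm.
Arguments Fm [o1 o2] _.

Lemma Fm_hom o1 o2 (f : mor (Wo k o1) (Wo k o2)) : ishom f -> ishom (Fm f).
Proof. by case: HF => _ H _ _ _; apply: H. Qed.

Lemma Fm_inj o1 o2 (f g : mor (Wo k o1) (Wo k o2)) :
  ishom f -> ishom g -> Fm f = Fm g -> f = g.
Proof. by case: HF => _ _ H _ _; apply: H. Qed.

Lemma Fm_surj o1 o2 (g : mor (Wo k (Fo o1)) (Wo k (Fo o2))) :
  ishom g -> exists2 f, ishom f & Fm f = g.
Proof. by case: HF => _ _ _ H _ /H [f [? ?]]; exists f. Qed.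

Lemma Fm_comp o1 o2 o3 (f : mor (Wo k o2) (Wo k o3)) (g : mor (Wo k o1) (Wo k o2)) :
  ishom f -> ishom g -> Fm (comp f g) = comp (Fm f) (Fm g).
Proof. by case: HF => _ _ _ _ [H _]; apply: H. Qed.

Lemma Fm_id o : Fm (idm (Wo k o)) = idm (Wo k (Fo o)).
Proof. by case: HF => _ _ _ _ [_ H]; apply: H. Qed.

Section Probe.
Variables (b b' : bool) (p : obj) (r : rep_elem k b p) (r' : rep_elem k b' (Fo p)).

(** The Yoneda translation of Hom(p, o) -> Hom(Fo p, Fo o). The sorts [b] and [b'] may differ, so
    that an exchange of sorts can be stated and refuted. *)
Definition transport (o : obj) (z : sort_of b (Wo k o)) : sort_of b' (Wo k (Fo o)) :=
  mor_on b' (Fm (re_e r z)) (re_u r').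

Lemma transport_elt o (z : sort_of b (Wo k o)) : Fm (re_e r z) = re_e r' (transport z).
Proof. by apply: re_uniq; apply: Fm_hom; apply: re_hom. Qed.

Lemma transport_nat o1 o2 (f : mor (Wo k o1) (Wo k o2)) z : ishom f ->
  transport (mor_on b f z) = mor_on b' (Fm f) (transport z).
Proof.
move=> hf; have E : re_e r (mor_on b f z) = comp f (re_e r z).
  have hc := comp_hom hf (re_hom r z); rewrite [RHS](re_uniq r hc).
  by rewrite mor_on_comp re_e_u.
rewrite {1}/transport E Fm_comp //; last exact: re_hom.
by rewrite mor_on_comp.
Qed.

Lemma transport_inj o : injective (@transport o).
Proof.
move=> z z' E; rewrite -(re_e_u r z) -(re_e_u r z'); congr (mor_on _ _ _).
by apply: Fm_inj; [apply: re_hom| apply: re_hom|rewrite !transport_elt E].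
Qed.

Lemma transport_surj o z' : exists z, @transport o z = z'.
Proof.
have [f hf Ef] := Fm_surj (re_hom r' z').
exists (mor_on b f (re_u r)); rewrite /transport -(re_uniq r hf) Ef; exact: re_e_u.
Qed.

(** Naturality along [zhom] at a preimage [z] of zero: [zhom] sends [z] to zero, and the
    homomorphism [Fm] of [zhom] preserves zero. *)
Lemma transport_zero o : @transport o (zero_on b _) = zero_on b' _.
Proof.
have [z Ez] := @transport_surj o (zero_on b' _).
have Fz := hom_zero_on b' (Fm_hom (zhom_hom k o o)).
have <- : mor_on b (zhom k o o) z = zero_on b (Wo k o) by case: (b) z {Ez}.
by rewrite transport_nat ?Ez //; apply: zhom_hom.
Qed.

Lemma transport_u : transport (re_u r) = re_u r'.
Proof.
have E : re_e r (re_u r) = idm _.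
  by rewrite [RHS](re_uniq r (id_hom _ _)) mor_on_id.
by rewrite /transport E Fm_id mor_on_id.
Qed.
End Probe.

Lemma comm_end_F o : comm_end k o -> comm_end k (Fo o).
Proof.
move=> H f g /Fm_surj[f0 hf <-] /Fm_surj[g0 hg <-].
by rewrite -!Fm_comp // H.
Qed.

(** If the identity of [Fo o] were zero, all endomorphisms of [Fo o] would coincide, against the
    injectivity of [Fm]. *)
Lemma idm_zhom_F o : idm (Wo k o) <> zhom k o o -> idm (Wo k (Fo o)) <> zhom k _ _.
Proof.
move=> H E; case: H; apply: Fm_inj; [exact: id_hom|exact: zhom_hom|].
rewrite Fm_id; have Ez f : ishom f -> f = zhom k (Fo o) (Fo o).
  move=> hf; have E1 : f = comp f (idm _) by apply: mor_ext.
  rewrite E1 E; apply: mor_ext => a.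
    exact: (hom_zero_on true hf).
  exact: (hom_zero_on false hf).
by rewrite [RHS]Ez //; apply: Fm_hom; apply: zhom_hom.
Qed.

Lemma F_PL_point : (exists x, Fo (PL 0) = PL x) \/ (exists y, Fo (PL 0) = PV y).
Proof.
apply: (@comm_end_point k); first exact: comm_end_F (@comm_pointL k 0).
apply: idm_zhom_F => E; have i0 : 0%N \in (PL 0).1 by apply: fset11.
have : cL (genL k i0) [:: 0%N] = cL (lzero (rL (Wo k (PL 0)))) [:: 0%N].
  exact: (congr1 (fun f : mor _ _ => cL (f.1 (genL k i0)) [:: 0%N]) E).
by rewrite cL_gen free_coefE eqxx => /eqP; rewrite oner_eq0.
Qed.

Lemma F_PV_point : (exists x, Fo (PV 0) = PL x) \/ (exists y, Fo (PV 0) = PV y).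
Proof.
apply: (@comm_end_point k); first exact: comm_end_F (@comm_pointV k 0).
apply: idm_zhom_F => E; have i0 : 0%N \in (PV 0).2 by apply: fset11.
have : cV (genV k i0) ([::], 0%N) = cV (vzero (Wo k (PV 0))) ([::], 0%N).
  exact: (congr1 (fun f : mor _ _ => cV (f.2 (genV k i0)) ([::], 0%N)) E).
by rewrite cV_gen free_coefE eqxx => /eqP; rewrite oner_eq0.
Qed.

(** Represents pairs of module elements; its module is k^2, so a natural binary operation on V is
    given by two coefficients. *)
Definition o01 : obj := (fset0, [fset 0%N; 1%N]%fset).
Lemma o01_0 : 0%N \in o01.2. Proof. by rewrite !inE. Qed.
Lemma o01_1 : 1%N \in o01.2. Proof. by rewrite !inE. Qed.

Lemma eltV2_0 o (u v : rV (Wo k o)) : (eltV2 o01 0 1 u v).2 (genV k o01_0) = u.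
Proof. by apply: cV_inj => q; rewrite eltV2E !free_coefE !cV_gen /= mul1r mul0r addr0. Qed.
Lemma eltV2_1 o (u v : rV (Wo k o)) : (eltV2 o01 0 1 u v).2 (genV k o01_1) = v.
Proof. by apply: cV_inj => q; rewrite eltV2E !free_coefE !cV_gen /= mul1r mul0r add0r. Qed.

(* Otherwise the bracket of L(F o) is transported to a v1 + b v2 on V(o); putting v2 = 0
   or v1 = 0 shows a = b = 0, so that all brackets vanish. *)
Lemma F_PV_neq_PL x : Fo (PV 0) <> PL x.
Proof.
move=> E; have xp : x \in (Fo (PV 0)).1 by rewrite E fset11.
have px : (Fo (PV 0)).1 = [fset x]%fset by rewrite E.
have p0 : (Fo (PV 0)).2 = fset0 by rewrite E.
pose r := repV k 0; pose r' := pointL k xp px p0.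
pose s o (v : rV (Wo k o)) : rL (Wo k (Fo o)) := transport r r' (v : sort_of false _).
have s_surj o l : exists v, s o v = l by apply: (transport_surj r r' (l : sort_of true _)).
have s_nat o o' (f : mor (Wo k o) (Wo k o')) v : ishom f -> s _ (f.2 v) = (Fm f).1 (s _ v).
  by move=> hf; apply: (@transport_nat false true _ r r' _ _ f v).
have inj q : injective (s q) by apply: (@transport_inj false true _ r r').
have s0 q : s q (vzero _) = lzero _ by apply: (@transport_zero false true _ r r').
have [[G GK GK'] _ _ _ _] := HF.
(* Chosen so that L(Fo o) is free on two generators and has a nonzero bracket. *)
pose o := G ([fset 0%N; 1%N], fset0)%fset.
have Eo : Fo o = ([fset 0%N; 1%N], fset0)%fset by apply: GK'.
have i0 : 0%N \in (Fo o).1 by rewrite Eo !inE.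
have i1 : 1%N \in (Fo o).1 by rewrite Eo !inE.
(* The bracket of the universal pair, pulled back; naturality along [eltV2] extends the formula to
   all pairs in [S]. *)
have [w Ew] := s_surj _ (lbr (s _ (genV k o01_0)) (s _ (genV k o01_1))).
pose al := cV w ([::], 0%N); pose be := cV w ([::], 1%N).
have S q (u v : rV (Wo k q)) : s _ (vadd (vscale al u) (vscale be v)) = lbr (s _ u) (s _ v).
  have hf := eltV2_hom o01 0 1 u v.
  have := s_nat _ _ _ w hf; have [_ _ hb _ _] := Fm_hom hf.
  by rewrite eltV2E => ->; rewrite Ew hb -!s_nat // eltV2_0 eltV2_1.
have g0 := cV_gen k (fset11 0%N : 0%N \in (PV 0).2).
set g := genV k _ in g0.
have al0 : al = 0.
  have : vadd (vscale al g) (vscale be (vzero _)) = vzero _.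
    apply: inj; rewrite S s0; apply: cL_inj => w'.
    by rewrite free_coefE /brA convA0r convA0l subrr.
  move/(congr1 (fun v => cV v ([::], 0%N))).
  by rewrite !free_coefE g0 eqxx mulr1 mulr0 addr0.
have be0 : be = 0.
  have : vadd (vscale al (vzero _)) (vscale be g) = vzero _.
    apply: inj; rewrite S s0; apply: cL_inj => w'.
    by rewrite free_coefE /brA convA0r convA0l subrr.
  move/(congr1 (fun v => cV v ([::], 0%N))).
  by rewrite !free_coefE g0 eqxx mulr1 mulr0 add0r.
have [u Eu] := s_surj _ (genL k i0).
have [v Ev] := s_surj _ (genL k i1).
have := S _ u v; rewrite Eu Ev al0 be0.
have -> : vadd (vscale 0 u) (vscale 0 v) = vzero (Wo k o).
  by apply: cV_inj => q; rewrite !free_coefE !mul0r addr0.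
rewrite s0 => /(congr1 (fun a => cL a [:: 0%N; 1%N])).
rewrite !free_coefE /brA !convA_cons !convA_nil !cL_gen /=.
rewrite !(mul0r, mulr0, add0r, addr0, mulr1, subr0).
by move/esym/eqP; rewrite oner_eq0.
Qed.

End Transport.

(** * The action on a free module *)

Section FreeAction.
Variables (k : fieldType) (o : obj).
Implicit Types (l : rL (Wo k o)) (v : rV (Wo k o)).

Lemma ractDl l l' v : ract (ladd l l') v = vadd (ract l v) (ract l' v).
Proof. by apply: cV_inj => -[w y]; rewrite !free_coefE -convADl. Qed.

Lemma ractZl z l v : ract (lscale z l) v = vscale z (ract l v).
Proof. by apply: cV_inj => -[w y]; rewrite !free_coefE -convAZl. Qed.

Lemma ractZr z l v : ract l (vscale z v) = vscale z (ract l v).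
Proof. by apply: cV_inj => -[w y]; rewrite !free_coefE -convAZr. Qed.

Lemma ract_br l l' v :
  ract (lbr l l') v = vadd (ract l (ract l' v)) (vopp (ract l' (ract l v))).
Proof.
apply: cV_inj => -[w y]; rewrite !free_coefE.
have A a b : convA (cL a) (fun u => cV (ract b v) (u, y)) w =
    convA (convA (cL a) (cL b)) (fun u => cV v (u, y)) w.
  by rewrite convA_assoc; apply: eq_convA.
by rewrite !A -convABl.
Qed.

Lemma convA_unit (a : word -> k) w : convA a (fun u => (u == [::])%:R) w = a w.
Proof.
elim: w a => [|x w IH] a; first by rewrite convA_nil eqxx mulr1.
by rewrite convA_cons mulr0 add0r IH.
Qed.

(** Lie elements are realised inside A(X), and acting on a free generator reproduces their
    coefficients. *)
Lemma ract_gen_inj l l' y (yo : y \in o.2) :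
  ract l (genV k yo) = ract l' (genV k yo) -> l = l'.
Proof.
move=> E; apply: cL_inj => w.
have C a : cV (ract a (genV k yo)) (w, y) = cL a w.
  rewrite cVM -[RHS]convA_unit; apply: eq_convA => // u.
  by rewrite cV_gen xpair_eqE eqxx andbT.
by rewrite -!C E.
Qed.

(** As [l] has no constant term, a word of length [i] arises in l^i v only from one letter of each
    factor and the constant term of [v]. *)
Lemma iter_act_coef l v i u y : size u = i ->
  cV (iter_act l v i) (u, y) = (\prod_(j <- u) cL l [:: j]) * cV v ([::], y).
Proof.
elim: i u => [|i IH] [|x u] // => [_|[Hu]]; first by rewrite big_nil mul1r.
rewrite iter_actS cVM convA_cons cL_nil mul0r add0r big_cons -mulrA -IH //.
case: u Hu => [|x' u] Hu; first by rewrite convA_nil.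
rewrite convA_cons [X in _ + X]big1 ?addr0 // => j _.
by rewrite iter_act_small ?mulr0 // -Hu ltnS size_drop leq_subr.
Qed.
End FreeAction.

(** Otherwise the nonzero polynomial X^i - X^j would vanish on arbitrarily long lists of distinct
    elements. *)
Lemma eq_expr_inj (k : fieldType) (kinf : forall s : seq k, exists x : k, x \notin s) i j :
  (forall x : k, x ^+ i = x ^+ j) -> i = j.
Proof.
move=> E; apply/eqP; apply/negP => /negP ne.
have uniqs n : exists s : seq k, uniq s /\ size s = n.
  elim: n => [|n [s [us <-]]]; first by exists [::].
  by have [x xs] := kinf s; exists (x :: s); rewrite /= xs.
pose p : {poly k} := 'X^i - 'X^j.
have p0 : p != 0.
  apply/eqP => /(congr1 (fun q : {poly k} => q`_i)).
  rewrite coefB !coefXn eqxx (negbTE ne) subr0 coef0 => /eqP.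
  by rewrite oner_eq0.
have [s [us Hs]] := uniqs (size p).
have := max_poly_roots p0 _ us; rewrite Hs ltnn => H; suff: false by [].
apply: H; apply/allP => x _.
by rewrite /root !hornerE E subrr.
Qed.

(** * The induced bijections are linear *)

Section Inner.
Variable k : fieldType.
Hypothesis k_infinite : forall s : seq k, exists x : k, x \notin s.
Hypothesis k_aut_trivial :
  forall f : {rmorphism k -> k}, bijective f -> forall x, f x = x.
Variables (Fo : obj -> obj)
  (Fm : forall o1 o2, mor (Wo k o1) (Wo k o2) -> mor (Wo k (Fo o1)) (Wo k (Fo o2))).
Hypothesis HF : cat_aut Fm.
Arguments Fm [o1 o2] _.

Lemma F_PV : exists y, Fo (PV 0) = PV y.
Proof. by case: (F_PV_point HF) => // -[x /(F_PV_neq_PL HF)]. Qed.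

(* Otherwise L(PV 0) = 0 would be in bijection with V(F (PV 0)), which is not 0. *)
Lemma F_PL : exists x, Fo (PL 0) = PL x.
Proof.
case: (F_PL_point HF) => // -[y' E].
have yp : y' \in (Fo (PL 0)).2 by rewrite E fset11.
have py : (Fo (PL 0)).2 = [fset y']%fset by rewrite E.
have p0 : (Fo (PL 0)).1 = fset0 by rewrite E.
pose r := repL k 0; pose r' := pointV k yp p0 py.
have [y EV] := F_PV; have yV : y \in (Fo (PV 0)).2 by rewrite EV fset11.
have [l El] := transport_surj HF r r' (genV k yV : sort_of false _).
have l0 : l = zero_on true (Wo k (PV 0)).
  by apply: cL_inj => w; rewrite (cL_empty l (erefl : (PV 0).1 = fset0)).
have := transport_zero HF r r' (PV 0); rewrite -l0 El.
move/(congr1 (fun v : rV _ => cV v ([::], y))); rewrite cV_gen eqxx free_coefE => /eqP.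
by rewrite oner_eq0.
Qed.

(** * The natural bijections on the two sorts *)

Section Main.
Variables x y : nat.
Hypotheses (EL : Fo (PL 0) = PL x) (EV : Fo (PV 0) = PV y).

Lemma memLx : x \in (Fo (PL 0)).1. Proof. by rewrite EL fset11. Qed.
Lemma FL1 : (Fo (PL 0)).1 = [fset x]%fset. Proof. by rewrite EL. Qed.
Lemma FL2 : (Fo (PL 0)).2 = fset0. Proof. by rewrite EL. Qed.
Lemma memVy : y \in (Fo (PV 0)).2. Proof. by rewrite EV fset11. Qed.
Lemma FV1 : (Fo (PV 0)).1 = fset0. Proof. by rewrite EV. Qed.
Lemma FV2 : (Fo (PV 0)).2 = [fset y]%fset. Proof. by rewrite EV. Qed.

Definition sL o (l : rL (Wo k o)) : rL (Wo k (Fo o)) :=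
  (Fm (eltL (PL 0) 0 l)).1 (genL k memLx).
Definition sV o (v : rV (Wo k o)) : rV (Wo k (Fo o)) :=
  (Fm (eltV (PV 0) 0 v)).2 (genV k memVy).

Let rL0 := repL k 0.
Let rL1 := pointL k memLx FL1 FL2.
Let rV0 := repV k 0.
Let rV1 := pointV k memVy FV1 FV2.

Lemma sL_elt o (l : rL (Wo k o)) : Fm (eltL (PL 0) 0 l) = eltL (Fo (PL 0)) x (sL l).
Proof. exact: (@transport_elt _ _ _ HF true true _ rL0 rL1 o l). Qed.
Lemma sV_elt o (v : rV (Wo k o)) : Fm (eltV (PV 0) 0 v) = eltV (Fo (PV 0)) y (sV v).
Proof. exact: (@transport_elt _ _ _ HF false false _ rV0 rV1 o v). Qed.
Lemma sL_nat o o' (f : mor (Wo k o) (Wo k o')) l : ishom f ->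
  sL (f.1 l) = (Fm f).1 (sL l).
Proof. exact: (@transport_nat _ _ _ HF true true _ rL0 rL1 o o' f l). Qed.
Lemma sV_nat o o' (f : mor (Wo k o) (Wo k o')) v : ishom f ->
  sV (f.2 v) = (Fm f).2 (sV v).
Proof. exact: (@transport_nat _ _ _ HF false false _ rV0 rV1 o o' f v). Qed.
Lemma sL_inj o : injective (@sL o).
Proof. exact: (@transport_inj _ _ _ HF true true _ rL0 rL1 o). Qed.
Lemma sV_inj o : injective (@sV o).
Proof. exact: (@transport_inj _ _ _ HF false false _ rV0 rV1 o). Qed.
Lemma sL_surj o l' : exists l, @sL o l = l'.
Proof. exact: (@transport_surj _ _ _ HF true true _ rL0 rL1 o l'). Qed.
Lemma sV_surj o v' : exists v, @sV o v = v'.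
Proof. exact: (@transport_surj _ _ _ HF false false _ rV0 rV1 o v'). Qed.
Lemma sL0 o : @sL o (lzero _) = lzero _.
Proof. exact: (@transport_zero _ _ _ HF true true _ rL0 rL1 o). Qed.
Lemma sV0 o : @sV o (vzero _) = vzero _.
Proof. exact: (@transport_zero _ _ _ HF false false _ rV0 rV1 o). Qed.

Lemma mem00L : 0%N \in (PL 0).1. Proof. exact: fset11. Qed.
Lemma mem00V : 0%N \in (PV 0).2. Proof. exact: fset11. Qed.

Lemma sV_gen : sV (genV k mem00V) = genV k memVy.
Proof.
have -> : genV k mem00V = re_u rV0 by congr genV; apply: bool_irrelevance.
exact: (@transport_u _ _ _ HF false false _ rV0 rV1).
Qed.

(** Addition pulled back along [sV] has the form al u + be v; putting one argument equal to zero and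
    cancelling [sV] gives al = be = 1. *)
Lemma sVD o (u v : rV (Wo k o)) : sV (vadd u v) = vadd (sV u) (sV v).
Proof.
have [w Ew] := sV_surj (vadd (sV (genV k o01_0)) (sV (genV k o01_1))).
have S q (u' v' : rV (Wo k q)) :
    sV (vadd (vscale (cV w ([::], 0%N)) u') (vscale (cV w ([::], 1%N)) v'))
    = vadd (sV u') (sV v').
  have hf := eltV2_hom o01 0 1 u' v'.
  have := sV_nat w hf; have [_ _ _ hD _] := Fm_hom HF hf.
  by rewrite eltV2E => ->; rewrite Ew hD -!sV_nat // eltV2_0 eltV2_1.
have al : cV w ([::], 0%N) = 1.
  have := S _ (genV k mem00V) (vzero _); rewrite sV0.
  have -> : vadd (sV (genV k mem00V)) (vzero _) = sV (genV k mem00V).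
    by apply: cV_inj => q; rewrite !free_coefE addr0.
  move/sV_inj/(congr1 (fun v => cV v ([::], 0%N))).
  by rewrite !free_coefE cV_gen eqxx mulr1 mulr0 addr0.
have be : cV w ([::], 1%N) = 1.
  have := S _ (vzero _) (genV k mem00V); rewrite sV0.
  have -> : vadd (vzero _) (sV (genV k mem00V)) = sV (genV k mem00V).
    by apply: cV_inj => q; rewrite !free_coefE add0r.
  move/sV_inj/(congr1 (fun v => cV v ([::], 0%N))).
  by rewrite !free_coefE cV_gen eqxx mulr1 mulr0 add0r.
rewrite -S al be; congr sV; congr vadd; apply: cV_inj => q; by rewrite free_coefE mul1r.
Qed.

(** The module of [Fo (PV 0)] is a line, so the image of [c] times the generator is a multiple of
    the generator; [rho c] is the factor. *)
Definition rho (c : k) : k := cV (sV (vscale c (genV k mem00V))) ([::], y).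

Lemma rhoE o c (v : rV (Wo k o)) : sV (vscale c v) = vscale (rho c) (sV v).
Proof.
have hf := eltV_hom (PV 0) 0 v.
have Ev z : (eltV (PV 0) 0 v).2 (vscale z (genV k mem00V)) = vscale z v.
  by apply: cV_inj => q; rewrite eltVE !free_coefE cV_gen eqxx mulr1.
rewrite -Ev sV_nat //.
have -> : sV (vscale c (genV k mem00V)) = vscale (rho c) (genV k memVy).
  apply: cV_inj => q; rewrite (cV_single _ FV1 FV2) free_coefE cV_gen.
  by rewrite /rho.
have [_ _ _ _ [hZ _]] := Fm_hom HF hf.
by rewrite hZ sV_elt eltVE; congr vscale; apply: cV_inj => q;
  rewrite free_coefE cV_gen eqxx mul1r.
Qed.

Lemma rho_gen c : sV (vscale c (genV k mem00V)) = vscale (rho c) (genV k memVy).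
Proof. by rewrite rhoE sV_gen. Qed.

(** [rho] is additive by [sVD], multiplicative by [rhoE] and onto because [sV] is, hence an
    automorphism of the field. *)
Lemma rho_id c : rho c = c.
Proof.
have co (d : k) : cV (vscale d (genV k memVy)) ([::], y) = d.
  by rewrite free_coefE cV_gen eqxx mulr1.
have rhoB : zmod_morphism rho.
  have rD a b : rho (a + b) = rho a + rho b.
    rewrite -[LHS]co -rho_gen.
    have -> : vscale (a + b) (genV k mem00V) =
        vadd (vscale a (genV k mem00V)) (vscale b (genV k mem00V)).
      by apply: cV_inj => q; rewrite !free_coefE mulrDl.
    by rewrite sVD !rho_gen free_coefE !co.
  by move=> a b; apply: (addIr (rho b)); rewrite -rD !subrK.
have rho1 : rho 1 = 1.
  rewrite /rho; have -> : vscale 1 (genV k mem00V) = genV k mem00V.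
    by apply: cV_inj => q; rewrite free_coefE mul1r.
  by rewrite sV_gen cV_gen eqxx.
have rhoM : monoid_morphism rho.
  split=> // a b; rewrite -[LHS]co -rho_gen.
  have -> : vscale (a * b) (genV k mem00V) = vscale a (vscale b (genV k mem00V)).
    by apply: cV_inj => q; rewrite !free_coefE mulrA.
  by rewrite rhoE free_coefE rho_gen co.
pose rA := GRing.isZmodMorphism.Build k k rho rhoB.
pose rM := GRing.isMonoidMorphism.Build k k rho rhoM.
pose f : {rmorphism k -> k} := HB.pack rho rA rM.
apply: (k_aut_trivial (f := f)).
(* A preimage of [d] times the generator lies on a line, so its only coefficient serves as [c0]. The
   boolean equality allows [xchoose] to build the inverse. *)
have surj d : exists c0, rho c0 == d.
  have [v Ev] := sV_surj (vscale d (genV k memVy)).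
  exists (cV v ([::], 0%N)); apply/eqP; rewrite -[LHS]co -rho_gen -[RHS]co -Ev.
  congr (cV (sV _) _); apply: cV_inj => q.
  have E1 : (PV 0).1 = fset0 by [].
  have E2 : (PV 0).2 = [fset 0%N]%fset by [].
  by rewrite [RHS](cV_single v E1 E2) free_coefE cV_gen.
exists (fun d => xchoose (surj d)) => d; last exact/eqP/(xchooseP (surj d)).
apply: (fmorph_inj f); apply/eqP; exact: (xchooseP (surj _)).
Qed.

Lemma sVZ o c (v : rV (Wo k o)) : sV (vscale c v) = vscale c (sV v).
Proof. by rewrite rhoE rho_id. Qed.

Definition phi (c : k) : k := cL (sL (lscale c (genL k mem00L))) [:: x].

Lemma phiE o c (l : rL (Wo k o)) : sL (lscale c l) = lscale (phi c) (sL l).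
Proof.
have hf := eltL_hom (PL 0) 0 l.
have Ev z : (eltL (PL 0) 0 l).1 (lscale z (genL k mem00L)) = lscale z l.
  by apply: cL_inj => q; rewrite eltLE !free_coefE cL_gen eqxx mulr1.
rewrite -Ev sL_nat //.
have -> : sL (lscale c (genL k mem00L)) = lscale (phi c) (genL k memLx).
  apply: cL_inj => q; rewrite (cL_single _ FL1) free_coefE cL_gen.
  by rewrite /phi.
have [_ hZ _ _ _] := Fm_hom HF hf.
by rewrite hZ sL_elt eltLE; congr lscale; apply: cL_inj => q;
  rewrite free_coefE cL_gen eqxx mul1r.
Qed.

(** * The action as a polynomial, and its degree *)

Definition P00 : obj := ([fset 0%N], [fset 0%N])%fset.
Lemma P00L : 0%N \in P00.1. Proof. exact: fset11. Qed.
Lemma P00V : 0%N \in P00.2. Proof. exact: fset11. Qed.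
Let X0 := genL k P00L.
Let Y0 := genV k P00V.

Lemma subst1_X0 o (l : rL (Wo k o)) v : (subst1 l v P00 0 0).1 X0 = l.
Proof. by apply: cL_inj => w; rewrite subst1_L free_coefE cL_gen eqxx mul1r. Qed.

Lemma subst1_single o (l : rL (Wo k o)) v (q : rV (Wo k P00)) i :
  (forall j, j != i -> cV q (nseq j 0%N, 0%N) = 0) ->
  (subst1 l v P00 0 0).2 q = vscale (cV q (nseq i 0%N, 0%N)) (iter_act l v i).
Proof.
move=> H; apply: cV_inj => p; rewrite subst1_V free_coefE (@subst1E _ _ _ _ _ _ _ i.+1).
  rewrite big_ord_recr big1 /= ?add0r // => j _.
  by rewrite H ?mul0r // neq_ltn ltn_ord.
by move=> j Hj; apply: H; rewrite neq_ltn Hj orbT.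
Qed.

Lemma subst1_Y0 o (l : rL (Wo k o)) v : (subst1 l v P00 0 0).2 Y0 = v.
Proof.
rewrite (@subst1_single _ _ _ _ 0) => [|j].
  by apply: cV_inj => q; rewrite free_coefE cV_gen eqxx mul1r.
by case: j.
Qed.

(** [q] is the pulled-back action on the universal pair [X0], [Y0]; naturality along [subst1]
    carries it to every pair. *)
Lemma act_poly : exists q : rV (Wo k P00),
  forall o (l : rL (Wo k o)) v, sV ((subst1 l v P00 0 0).2 q) = ract (sL l) (sV v).
Proof.
have [q Eq] := sV_surj (ract (sL X0) (sV Y0)); exists q => o l v.
have hf : ishom (subst1 l v P00 0 0) by apply: subst1_hom.
have [_ _ _ _ [_ hA]] := Fm_hom HF hf.
by rewrite sV_nat // Eq -hA -sV_nat // -sL_nat // subst1_X0 subst1_Y0.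
Qed.

Lemma iter_act_scale c i j : cV (iter_act (lscale c X0) Y0 j) (nseq i 0%N, 0%N) =
  c ^+ j * (i == j)%:R.
Proof.
elim: j i => [|j IH] [|i].
- by rewrite cV_gen eqxx mul1r.
- by rewrite cV_gen mulr0.
- by rewrite iter_actS cV_act_nil mulr0.
rewrite iter_actS ractZl cVZ cVM exprS -mulrA eqSS -IH; congr (_ * _).
by rewrite convA_delta /= mul1r.
Qed.

Lemma iter_act_gen i j : cV (iter_act X0 Y0 j) (nseq i 0%N, 0%N) = (i == j)%:R.
Proof.
have -> : X0 = lscale 1 X0 by apply: cL_inj => w; rewrite free_coefE mul1r.
by rewrite iter_act_scale expr1n mul1r.
Qed.

(** Scaling [l] by [c] multiplies the degree [j] coefficient of [q] by c^j, and also by [phi c].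
    Every nonzero coefficient thus gives phi c = c^j, which over an infinite field allows one [j]
    only. *)
Lemma act_mono : exists (i : nat) (a : k), [/\ a != 0, forall c, phi c = c ^+ i &
  forall o (l : rL (Wo k o)) v, ract (sL l) (sV v) = sV (vscale a (iter_act l v i))].
Proof.
have [q Hq] := act_poly; pose qc j := cV q (nseq j 0%N, 0%N).
have qphi c j : c ^+ j * qc j = phi c * qc j.
  have q1 : (subst1 X0 Y0 P00 0 0).2 q = q.
    apply: cV_inj => -[w z]; rewrite subst1_V /subst1_fun /=.
    have [/andP[Hw Hz]|H] := boolP (all (fun t => t \in P00.1) w && (z \in P00.2)); last first.
      rewrite (cV_out _ H) big1 // => j' _.
      by rewrite (cV_out _ H) mulr0.
    have -> : w = nseq (size w) 0%N.
      by apply/all_pred1P; apply: sub_all Hw => t /fset1P ->.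
    have -> : z = 0%N by apply/fset1P.
    rewrite size_nseq big_ord_recr big1 /= ?add0r => [|j' _].
      by rewrite iter_act_gen eqxx mulr1.
    by rewrite iter_act_gen gtn_eqF ?mulr0.
  have : sV ((subst1 (lscale c X0) Y0 P00 0 0).2 q) = sV (vscale (phi c) q).
    by rewrite Hq phiE ractZl -Hq q1 sVZ.
  move/sV_inj/(congr1 (fun m => cV m (nseq j 0%N, 0%N))).
  rewrite subst1_V /subst1_fun free_coefE /= size_nseq big_ord_recr big1 /= ?add0r => [|j' _].
    by rewrite iter_act_scale eqxx mulr1 mulrC.
  by rewrite iter_act_scale gtn_eqF ?mulr0.
have [i qi] : exists i, qc i != 0.
  have [N HN] := modelem_bound (proj2_sig q).
  case: (pickP (fun i : 'I_N => qc i != 0)) => [i Hi|H]; first by exists i.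
  (* If [q] vanished, so would the action on W(Fo o) for every [o]; choosing Fo o = [P00]
     contradicts x0 y0 != 0. *)
  have q0 j : qc j = 0.
    have [le|lt] := leqP N j; first exact: HN.
    by apply/eqP; have /negbFE := H (Ordinal lt).
  have [[G GK GK'] _ _ _ _] := HF.
  have oL : 0%N \in (Fo (G P00)).1 by rewrite GK' P00L.
  have oV : 0%N \in (Fo (G P00)).2 by rewrite GK' P00V.
  have [l El] := sL_surj (genL k oL); have [v Ev] := sV_surj (genV k oV).
  have := Hq _ l v; rewrite (@subst1_single _ _ _ _ 0) => [|j _]; last exact: q0.
  rewrite -/(qc 0) q0 El Ev.
  have -> : vscale 0 (iter_act l v 0) = vzero _ by apply: cV_inj => p; rewrite !free_coefE mul0r.
  rewrite sV0 => /(congr1 (fun m => cV m ([:: 0%N], 0%N))).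
  rewrite !free_coefE convA_letter ?cL_nil // cL_gen cV_gen !eqxx mul1r => /esym/eqP.
  by rewrite oner_eq0.
have phii c : phi c = c ^+ i by apply: (mulIf qi); rewrite -qphi.
exists i, (qc i); split => // o l v.
rewrite -Hq (@subst1_single _ _ _ _ i) // => j ne.
apply/eqP; apply: contraNT ne => qj; apply/eqP; apply: (eq_expr_inj k_infinite) => c.
by rewrite -phii; apply: (mulIf qj); rewrite qphi.
Qed.

Definition Q : obj := ([fset 0%N; 1%N], [fset 0%N])%fset.
Lemma Q0 : 0%N \in Q.1. Proof. by rewrite !inE. Qed.
Lemma Q1 : 1%N \in Q.1. Proof. by rewrite !inE. Qed.
Lemma QV : 0%N \in Q.2. Proof. exact: fset11. Qed.

(* Compare coefficients of words of length i in w^i = x0^i + x1^i. *)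
Lemma act_degree1 i a : a != 0 ->
  (forall o (l : rL (Wo k o)) v, ract (sL l) (sV v) = sV (vscale a (iter_act l v i))) ->
  i = 1%N.
Proof.
move=> a0 H; pose L0 := genL k Q0; pose L1 := genL k Q1; pose Y := genV k QV.
have [w Ew] := sL_surj (ladd (sL L0) (sL L1)).
have E u : size u = i -> \prod_(j <- u) cL w [:: j] =
    \prod_(j <- u) cL L0 [:: j] + \prod_(j <- u) cL L1 [:: j].
  move=> Hu; have := H _ w Y; rewrite Ew ractDl !H -sVD.
  move/sV_inj/(congr1 (fun m => cV m (u, 0%N))).
  rewrite !free_coefE !(@iter_act_coef _ _ _ _ i) // cV_gen eqxx !mulr1 -mulrDr.
  by move/(mulfI a0) => ->.
have P l z : \prod_(j <- nseq i z) cL (l : rL (Wo k Q)) [:: j] = cL l [:: z] ^+ i.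
  by rewrite big_nseq; elim: (i) => //= n ->; rewrite exprS.
case: i => [|[//|i]] in H E P *.
  (* In degree 0 the empty word gives 1 = 1 + 1. *)
  have := E [::] erefl; rewrite !big_nil => /esym/eqP.
  by rewrite -subr_eq0 addrK oner_eq0.
have := E _ (size_nseq _ 0%N); rewrite !P !cL_gen /= expr1n expr0n addr0 => Ea.
have := E _ (size_nseq _ 1%N); rewrite !P !cL_gen /= expr1n expr0n add0r => Eb.
(* A mixed word has coefficient 0 on the right, whereas the pure words [Ea] and [Eb] make both
   letters of [w] occur. *)
have := E (1%N :: 0%N :: nseq i 0%N); rewrite [size _]/= size_nseq !big_cons !cL_gen /=.
rewrite !(mul0r, mulr0) addr0 => /(_ erefl)/eqP.
have wa : cL w [:: 0%N] != 0.
  by apply/eqP => w0; move: Ea => /eqP; rewrite w0 expr0n eq_sym oner_eq0.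
have wb : cL w [:: 1%N] != 0.
  by apply/eqP => w0; move: Eb => /eqP; rewrite w0 expr0n eq_sym oner_eq0.
rewrite !mulf_eq0 (negbTE wa) (negbTE wb) /=.
have -> : \prod_(j <- nseq i 0%N) cL w [:: j] = cL w [:: 0%N] ^+ i.
  by rewrite big_nseq; elim: (i) => //= n ->; rewrite exprS.
by rewrite expf_eq0 (negbTE wa) andbF.
Qed.

Lemma act_linear : exists2 a : k, a != 0 & (forall c, phi c = c) /\
  forall o (l : rL (Wo k o)) v, ract (sL l) (sV v) = sV (vscale a (ract l v)).
Proof.
have [i [a [a0 Hphi H]]] := act_mono; have i1 := act_degree1 a0 H; subst i.
by exists a.
Qed.

(** * Linearity on the Lie sort and the isomorphism W(o) -> W(Fo o) *)

Section Faithful.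
Variable a : k.
Hypothesis a0 : a != 0.
Hypothesis phi_id : forall c, phi c = c.
Hypothesis act : forall o (l : rL (Wo k o)) v,
  ract (sL l) (sV v) = sV (vscale a (ract l v)).

Lemma sLZ o c (l : rL (Wo k o)) : sL (lscale c l) = lscale c (sL l).
Proof. by rewrite phiE phi_id. Qed.

(** V(o) is nonzero and [sV] injective, so [Fo o] has a module generator; it has the form [sV v],
    and the action on it is faithful. *)
Lemma F_faithful o (oV : 0%N \in o.2) (z z' : rL (Wo k (Fo o))) :
  (forall v, ract z (sV v) = ract z' (sV v)) -> z = z'.
Proof.
move=> H; have [V0|[t tV]] := fset_0Vmem (Fo o).2.
  have : sV (genV k oV) = sV (vzero _) by apply: cV_inj => q; rewrite !(cV_empty _ V0).
  move/sV_inj/(congr1 (fun m => cV m ([::], 0%N)))/eqP.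
  by rewrite cV_gen free_coefE eqxx oner_eq0.
have [v Ev] := sV_surj (genV k tV).
by apply: (ract_gen_inj (yo := tV)); rewrite -Ev.
Qed.

(* V(X,Y) may be 0; adding a module generator makes the action faithful. *)
Definition iota (X Y : {fset nat}) := lie_hom k X Y [fset 0%N]%fset.
Lemma iota_hom X Y : ishom (iota X Y). Proof. exact: lie_homP. Qed.

Lemma F_iota_inj X Y : injective (Fm (iota X Y)).1.
Proof.
pose f := lie_hom k X [fset 0%N]%fset Y.
have hf : ishom f by apply: lie_homP.
move=> z z'; have [l <-] := sL_surj z; have [l' <-] := sL_surj z'.
rewrite -!sL_nat ?iota_hom; try exact: iota_hom.
(* The carrier of L(X) does not depend on the module generators, so [E] also holds in W(X, Y). *)
by move/sL_inj => E; congr sL.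
Qed.

(** After [iota] both sides can be compared by their action on all [sV v], where [act] reduces the
    claim to additivity of [sV]. *)
Lemma sLD o (l l' : rL (Wo k o)) : sL (ladd l l') = ladd (sL l) (sL l').
Proof.
case: o l l' => X Y l l'; apply: F_iota_inj; have h := iota_hom X Y.
have [hD _ _ _ _] := Fm_hom HF h; rewrite hD -!sL_nat //.
apply: F_faithful => [|v]; first exact: fset11.
rewrite ractDl !act -sVD; congr sV; have [-> _ _ _ _] := h.
by rewrite ractDl; apply: cV_inj => q; rewrite !free_coefE mulrDr.
Qed.

(** On the right [act] is applied twice and yields a^2, on the left only once; hence the factor [a]
    inside [sL]. *)
Lemma sL_br o (l l' : rL (Wo k o)) : sL (lscale a (lbr l l')) = lbr (sL l) (sL l').
Proof.
case: o l l' => X Y l l'; apply: F_iota_inj; have h := iota_hom X Y.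
have [_ _ hB _ _] := Fm_hom HF h; rewrite hB -!sL_nat //.
apply: F_faithful => [|v]; first exact: fset11.
have [_ hZ hb _ _] := h; rewrite hZ hb ract_br !act.
rewrite ractZl ract_br !ractZr !sVZ.
have N u : sV (vopp u) = vopp (sV u).
  have -> : vopp u = vscale (-1) u by apply: cV_inj => q; rewrite !free_coefE mulN1r.
  by rewrite sVZ; apply: cV_inj => q; rewrite !free_coefE mulN1r.
by rewrite sVD N; apply: cV_inj => q; rewrite !(cVD, cVN, cVZ); ring.
Qed.

(** Dividing by [a] corrects the bracket and the action at once. *)
Definition tiso o : mor (Wo k o) (Wo k (Fo o)) :=
  (fun l => lscale a^-1 (sL l), @sV o).

Lemma tisoL o l : (tiso o).1 l = lscale a^-1 (sL l). Proof. by []. Qed.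
Lemma tisoV o v : (tiso o).2 v = sV v. Proof. by []. Qed.

Lemma tiso_hom o : ishom (tiso o).
Proof.
split; [..|split] => *; rewrite ?tisoL ?tisoV.
- by rewrite sLD; apply: cL_inj => w; rewrite !free_coefE mulrDr.
- by rewrite sLZ; apply: cL_inj => w; rewrite !free_coefE mulrCA.
- apply: cL_inj => w; rewrite !(cLZ, cLB) /brA !(convAZl, convAZr) -!mulrBr.
  by rewrite -/(brA _ _ w) -cLB -sL_br sLZ cLZ mulKf.
- exact: sVD.
- exact: sVZ.
- by rewrite ractZl act sVZ; apply: cV_inj => q; rewrite !cVZ mulKf.
Qed.

End Faithful.
End Main.
End Inner.

(** * Closed congruences *)

Section Closed.
Variable k : fieldType.

Lemma vspace_idem (T : Type) z add opp (sc : k -> T -> T) x :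
  is_vspace z add opp sc -> add x x = x -> x = z.
Proof.
move=> [addA _ add0 addN _] E.
by rewrite -[LHS]add0 -(addN x) -addA E.
Qed.

Lemma vspace_scale0 (T : Type) z add opp (sc : k -> T -> T) c :
  is_vspace z add opp sc -> sc c z = z.
Proof.
move=> vs; apply: (vspace_idem vs); case: vs => _ _ add0 _ [scD _ _ _].
by rewrite -scD add0.
Qed.

Section Hom.
Variables (H : repSig k) (repH : is_rep H) (o : obj).
Implicit Types (f : mor (Wo k o) H) (T : pairs k o).

Lemma hom_L0 f : ishom f -> f.1 (lzero _) = lzero _.
Proof.
move=> [hD _ _ _ _]; have [[vs _ _ _ _] _ _ _ _] := repH.
apply: (vspace_idem vs); rewrite -hD; congr (f.1 _).
by apply: cL_inj => w; rewrite !free_coefE addr0.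
Qed.

Lemma hom_V0 f : ishom f -> f.2 (vzero _) = vzero _.
Proof.
move=> [_ _ _ hD _]; have [_ vs _ _ _] := repH.
apply: (vspace_idem vs); rewrite -hD; congr (f.2 _).
by apply: cV_inj => w; rewrite !free_coefE addr0.
Qed.

Lemma pairs_ext T T' :
  (forall l, T.1 l <-> T'.1 l) -> (forall v, T.2 v <-> T'.2 v) -> T = T'.
Proof.
case: T T' => [T1 T2] [S1 S2] /= E1 E2; congr pair;
  by apply: functional_extensionality => z; apply: propositional_extensionality.
Qed.

Lemma closedL T l : closed H T -> (T.1 l <-> forall f, prime T f -> f.1 l = lzero (rL H)).
Proof. by move=> cT; rewrite -[in X in X <-> _]cT. Qed.

Lemma closedV T v : closed H T -> (T.2 v <-> forall f, prime T f -> f.2 v = vzero H).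
Proof. by move=> cT; rewrite -[in X in X <-> _]cT. Qed.

Lemma sub_dprime T : (forall l, T.1 l -> (dprime H T).1 l) /\
  (forall v, T.2 v -> (dprime H T).2 v).
Proof. by split=> z Tz f [_ h1 h2]; [apply: h1|apply: h2]. Qed.

Lemma dprime_min T S : closed H S -> (forall l, T.1 l -> S.1 l) ->
  (forall v, T.2 v -> S.2 v) ->
  (forall l, (dprime H T).1 l -> S.1 l) /\ (forall v, (dprime H T).2 v -> S.2 v).
Proof.
move=> cS h1 h2; have P f : prime S f -> prime T f.
  by move=> [hf s1 s2]; split=> // z; [move/h1/s1|move/h2/s2].
split=> z Tz; [apply/(closedL _ cS)|apply/(closedV _ cS)] => f /P; exact: Tz.
Qed.

Lemma dprime_closed T : closed H (dprime H T).
Proof.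
apply: pairs_ext => z; split; try by apply sub_dprime.
- by move=> h f pf; apply: h; split; case: pf => // hf h1 h2 z' /(_ f); apply; split.
- by move=> h f pf; apply: h; split; case: pf => // hf h1 h2 z' /(_ f); apply; split.
Qed.

Lemma closedI T : (forall l, (dprime H T).1 l -> T.1 l) ->
  (forall v, (dprime H T).2 v -> T.2 v) -> closed H T.
Proof.
move=> h1 h2; have [s1 s2] := sub_dprime T.
by apply: pairs_ext => z; split; auto.
Qed.

Lemma closed_L0 T : closed H T -> T.1 (lzero _).
Proof. by move=> cT; apply/(closedL _ cT) => f [hf _ _]; apply: hom_L0. Qed.

Lemma closed_V0 T : closed H T -> T.2 (vzero _).
Proof. by move=> cT; apply/(closedV _ cT) => f [hf _ _]; apply: hom_V0. Qed.

Lemma closed_LZ T c l : closed H T -> T.1 l -> T.1 (lscale c l).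
Proof.
move=> cT Tl; apply/(closedL _ cT) => f pf; have [[_ hZ _ _ _] h1 _] := pf.
have [[vs _ _ _ _] _ _ _ _] := repH.
by rewrite hZ h1 // (vspace_scale0 _ vs).
Qed.

Lemma closed_VZ T c v : closed H T -> T.2 v -> T.2 (vscale c v).
Proof.
move=> cT Tv; apply/(closedV _ cT) => f pf; have [[_ _ _ _ [hZ _]] _ h2] := pf.
have [_ vs _ _ _] := repH.
by rewrite hZ h2 // (vspace_scale0 _ vs).
Qed.

(** Expresses membership in a closed pair by [beta], which [Fm] can transport. The differences of
    values are the multiples of [l], and the generator gives [l] itself. *)
Lemma beta_eltL T p x (xp : x \in p.1) l : closed H T ->
  beta T (eltL p x l) (eltL p x (lzero _)) <-> T.1 l.
Proof.
move=> cT.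
have E a : ladd ((eltL p x l).1 a) (lopp ((eltL p x (lzero (rL (Wo k o)))).1 a)) =
    lscale (cL a [:: x]) l.
  by apply: cL_inj => w; rewrite cLD cLN !eltLE !free_coefE mulr0 subr0.
split=> [[_ _ h _]|Tl].
  have := h (genL k xp); rewrite E cL_gen eqxx; congr (T.1 _).
  by apply: cL_inj => w; rewrite free_coefE mul1r.
split; [exact: eltL_hom|exact: eltL_hom| |].
  by move=> a; rewrite E; apply: closed_LZ.
move=> v; rewrite !eltE [X in T.2 X](_ : _ = vzero _); first exact: closed_V0.
by apply: cV_inj => q; rewrite !free_coefE subr0.
Qed.

Lemma beta_eltV T p y (yp : y \in p.2) v : closed H T ->
  beta T (eltV p y v) (eltV p y (vzero _)) <-> T.2 v.
Proof.
move=> cT.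
have E a : vadd ((eltV p y v).2 a) (vopp ((eltV p y (vzero (Wo k o))).2 a)) =
    vscale (cV a ([::], y)) v.
  by apply: cV_inj => w; rewrite cVD cVN !eltVE !free_coefE mulr0 subr0.
split=> [[_ _ _ h]|Tl].
  have := h (genV k yp); rewrite E cV_gen eqxx; congr (T.2 _).
  by apply: cV_inj => w; rewrite free_coefE mul1r.
split; [exact: eltV_hom|exact: eltV_hom| |]; last first.
  by move=> a; rewrite E; apply: closed_VZ.
move=> l; rewrite !eltE [X in T.1 X](_ : _ = lzero _); first exact: closed_L0.
by apply: cL_inj => q; rewrite !free_coefE subr0.
Qed.
End Hom.

(** * Comparison of the two equivalences *)

Lemma inv_hom (A B : repSig k) (t : mor A B) : ishom t ->
  injective t.1 -> injective t.2 ->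
  (forall l, exists l', t.1 l' = l) -> (forall v, exists v', t.2 v' = v) ->
  exists u : mor B A, [/\ ishom u, cancel t.1 u.1 & cancel t.2 u.2].
Proof.
move=> [h1 h2 h3 h4 [h5 h6]] i1 i2 s1 s2.
pose u1 l := proj1_sig (constructive_indefinite_description _ (s1 l)).
pose u2 v := proj1_sig (constructive_indefinite_description _ (s2 v)).
have t1 l : t.1 (u1 l) = l by rewrite /u1; case: constructive_indefinite_description.
have t2 v : t.2 (u2 v) = v by rewrite /u2; case: constructive_indefinite_description.
exists (u1, u2); split; last 2 first.
- by move=> l; apply: i1; rewrite t1.
- by move=> v; apply: i2; rewrite t2.
split; [..|split] => /=.
- by move=> l l'; apply: i1; rewrite h1 !t1.
- by move=> c l; apply: i1; rewrite h2 !t1.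
- by move=> l l'; apply: i1; rewrite h3 !t1.
- by move=> v v'; apply: i2; rewrite h4 !t2.
- by move=> c v; apply: i2; rewrite h5 !t2.
- by move=> l v; apply: i2; rewrite -h6 t1 !t2.
Qed.

(** [dprime H T] is the least [H]-closed pair containing [T], so the closed pairs determine it. *)
Lemma geom_equivP (H1 H2 : repSig k) :
  (forall o (T : pairs k o), closed H1 T <-> closed H2 T) -> geom_equiv H1 H2.
Proof.
move=> HC o T.
have D (G G' : repSig k) : (forall o (T : pairs k o), closed G T -> closed G' T) ->
    (forall l, (dprime G' T).1 l -> (dprime G T).1 l) /\
    (forall v, (dprime G' T).2 v -> (dprime G T).2 v).
  move=> HG; have [s1 s2] := sub_dprime G T.
  by apply: dprime_min => //; apply/HG/dprime_closed.
have [a1 a2] := D H1 H2 (fun o T => proj1 (HC o T)).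
have [b1 b2] := D H2 H1 (fun o T => proj2 (HC o T)).
by apply: pairs_ext => z; split; auto.
Qed.

Lemma geom_equiv_auto (H1 H2 : repSig k) : geom_equiv H1 H2 -> auto_equiv H1 H2.
Proof.
move=> E; have HC o (T : pairs k o) : closed H1 T <-> closed H2 T by rewrite /closed E.
exists id, (fun o1 o2 f => f); split.
  split=> //; [by exists id|by move=> o1 o2 g hg; exists g].
exists (fun o T => T); split.
  by move=> o; split=> // [T /HC|S /HC] //; exists S.
move=> o1 o2 T cT f' g'; split; first by move=> [f [g [b <- <-]]].
by exists f', g'.
Qed.

Lemma auto_equiv_geom (H1 H2 : repSig k) :
  (forall s : seq k, exists x : k, x \notin s) ->
  (forall f : {rmorphism k -> k}, bijective f -> forall x, f x = x) ->
  is_rep H1 -> is_rep H2 -> auto_equiv H1 H2 -> geom_equiv H1 H2.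
Proof.
move=> kinf kaut r1 r2 [Fo [Fm [HF [al [Hal Hbeta]]]]].
have [x EL] := F_PL HF; have [y EV] := F_PV HF.
have [a a0 [phiid act]] := act_linear kinf kaut HF EL EV.
have xL := memLx EL; have yV := memVy EV.
pose t o := tiso Fm EL EV a o.
have th o : ishom (t o) by apply: tiso_hom.
have alL o (T : pairs k o) l : closed H1 T -> T.1 l <-> (al o T).1 ((t o).1 l).
  move=> cT; have [c2 _ _] := Hal o; have {}c2 := c2 _ cT.
  (* A closed pair is stable under scalars, so the factor [a^-1] in [t] is harmless. *)
  have -> : (al o T).1 ((t o).1 l) <-> (al o T).1 (sL Fm EL l).
    split=> h; last exact: (closed_LZ r2 _ c2 h).
    have := closed_LZ r2 a c2 h; congr ((al o T).1 _).
    by apply: cL_inj => w; rewrite /t tisoL !free_coefE mulVKf.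
  rewrite -(beta_eltL r1 (mem00L : 0%N \in (PL 0).1) l cT).
  rewrite -(beta_eltL r2 xL (sL Fm EL l) c2).
  have E0 : eltL (Fo (PL 0)) x (lzero (rL (Wo k (Fo o)))) = Fm _ _ (eltL (PL 0) 0 (lzero _)).
    by rewrite (sL_elt HF EL) (sL0 HF).
  rewrite E0 -(sL_elt HF EL) -Hbeta //; split=> [b|[f [g [b Ef Eg]]]].
    by exists (eltL (PL 0) 0 l), (eltL (PL 0) 0 (lzero _)).
  have [hf hg _ _] := b.
  by rewrite -(Fm_inj HF hf (eltL_hom _ _ _) Ef) -(Fm_inj HF hg (eltL_hom _ _ _) Eg).
have alV o (T : pairs k o) v : closed H1 T -> T.2 v <-> (al o T).2 ((t o).2 v).
  move=> cT; have [c2 _ _] := Hal o; have {}c2 := c2 _ cT.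
  rewrite /t tisoV -(beta_eltV r1 (mem00V : 0%N \in (PV 0).2) v cT).
  rewrite -(beta_eltV r2 yV (sV Fm EV v) c2).
  have E0 : eltV (Fo (PV 0)) y (vzero (Wo k (Fo o))) = Fm _ _ (eltV (PV 0) 0 (vzero _)).
    by rewrite (sV_elt HF EV) (sV0 HF).
  rewrite E0 -(sV_elt HF EV) -Hbeta //; split=> [b|[f [g [b Ef Eg]]]].
    by exists (eltV (PV 0) 0 v), (eltV (PV 0) 0 (vzero _)).
  have [hf hg _ _] := b.
  by rewrite -(Fm_inj HF hf (eltV_hom _ _ _) Ef) -(Fm_inj HF hg (eltV_hom _ _ _) Eg).
(* By [alL] and [alV], [T] is the preimage of the [H2]-closed pair [al o T] under [t o]; composing
   with [t o] turns the homomorphisms that define the latter into ones that vanish on [T]. *)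
apply: geom_equivP => o T; split=> cT.
  have [c2 _ _] := Hal o; have {}c2 := c2 _ cT.
  have P g : prime (al o T) g -> prime T (comp g (t o)).
    move=> [hg g1 g2]; split; first exact: comp_hom.
      by move=> l /(alL _ _ _ cT)/g1.
    by move=> v /(alV _ _ _ cT)/g2.
  apply: closedI => z Tz.
    by apply/(alL _ _ _ cT)/(closedL _ c2) => g /P/Tz.
  by apply/(alV _ _ _ cT)/(closedV _ c2) => g /P/Tz.
have [u [hu uL uV]] : exists u : mor (Wo k (Fo o)) (Wo k o),
    [/\ ishom u, cancel (t o).1 u.1 & cancel (t o).2 u.2].
  apply: inv_hom => //.
  - move=> l l'; rewrite /t !tisoL => E; apply: (@sL_inj _ _ _ HF _ EL); apply: cL_inj => w.
    move/(congr1 (fun m => cL m w)): E; rewrite !free_coefE.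
    by apply: mulfI; rewrite invr_eq0.
  - exact: sV_inj.
  - move=> l; have [l' El] := sL_surj HF EL (lscale a l); exists l'.
    by rewrite /t tisoL El; apply: cL_inj => w; rewrite !free_coefE mulKf.
  - by move=> v; apply: sV_surj.
(* Conversely, the copy of [T] in W(Fo o) is [H2]-closed, hence equal to [al o T'] for an
   [H1]-closed [T']; pulling back along [t o] gives T = T'. *)
pose S : pairs k (Fo o) := (fun l => T.1 (u.1 l), fun v => T.2 (u.2 v)).
have cS : closed H2 S.
  have P g : prime T g -> prime S (comp g u).
    by move=> [hg g1 g2]; split; [exact: comp_hom|move=> l /g1|move=> v /g2].
  apply: closedI => z Sz.
    by apply/(closedL _ cT) => g /P/Sz.
  by apply/(closedV _ cT) => g /P/Sz.
have [_ _ /(_ _ cS)[T' [cT' ET']]] := Hal o.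
suff -> : T = T' by [].
apply: pairs_ext => z.
  by rewrite (alL _ _ _ cT') ET' /S /= uL.
by rewrite (alV _ _ _ cT') ET' /S /= uV.
Qed.
End Closed.

Theorem theorem8 (k : fieldType)
  (k_infinite : forall s : seq k, exists x : k, x \notin s)
  (k_char0 : [pchar k] =i pred0)
  (k_aut_trivial : forall f : {rmorphism k -> k}, bijective f -> forall x, f x = x)
  (H1 H2 : repSig k) (rep1 : is_rep H1) (rep2 : is_rep H2) :
  auto_equiv H1 H2 <-> geom_equiv H1 H2.
Proof.
split; first exact: auto_equiv_geom.
exact: geom_equiv_auto.
Qed.
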